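(* Let $\mathbf{F}$ be a finite field of odd cardinality $q$, let $\pi\in\mathbf{F}^\times$ be a non-square, let $(G,\mathbf{V})$ be the infinite orthogonal group over $\mathbf{F}$, and let $\mathbb{B}=\mathbb{B}(G,\mathbf{V})$ be its relative Burnside ring, with $\mathbb{Z}$-basis the classes $x_{a,\epsilon,b}$ of the $G$-sets $X_{a,\epsilon,b}$. There is a ring isomorphism $$\mathbb{Z}[1/2q][X,Y,Z]/(F)\to\mathbb{B}[1/2q],\qquad X\mapsto x_{1,1,0},\quad Y\mapsto x_{1,\pi,0},\quad Z\mapsto x_{0,0,1},$$ where $$F=\left(1-\tfrac12X-\tfrac12Y+Z\right)(X-Y).$$
   Context: A quadratic space is an $\mathbf{F}$-vector space with a symmetric bilinear form; an embedding is an injective linear map preserving forms. $\mathbf{V}$ has basis $\{e_i,f_i\}_{i\ge1}$ and form $\langle e_i,e_j\rangle=\langle f_i,f_j\rangle=0$, $\langle e_i,f_j\rangle=\delta_{i,j}$; $G$ is its group of form-preserving linear automorphisms. The modified discriminant of a quadratic space of dimension $2r$ or $2r+1$ is $(-1)^r$ times its discriminant. $V_{m,\delta}$ is the non-degenerate quadratic space of dimension $m$ and modified discriminant $\delta\in\mathbf{F}^\times/(\mathbf{F}^\times)^2$; $V_{m,\delta,n}$ is the orthogonal sum of $V_{m,\delta}$ and an $n$-dimensional space with zero form. Every finite dimensional quadratic space is isomorphic to a unique $V_{m,\delta,n}$, except that $\delta$ is irrelevant when $m=0$ (so $V_{0,0,1}$ denotes the one-dimensional space with zero form). $X_{m,\delta,n}$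 is the set of embeddings $V_{m,\delta,n}\to\mathbf{V}$, with its transitive $G$-action by post-composition. A $G$-set is $\mathbf{V}$-smooth if all its stabilizers are pointwise stabilizers $G(A)$ of finite subsets $A\subset\mathbf{V}$; the $X_{m,\delta,n}$ are, up to isomorphism, exactly the transitive ones. The relative Burnside ring $\mathbb{B}(G,\mathbf{V})$ is the free abelian group on isomorphism classes of transitive $\mathbf{V}$-smooth $G$-sets, with the class of a $\mathbf{V}$-smooth $G$-set with finitely many orbits defined as the sum of the classes of its orbits, and product given by the class of the Cartesian product (which has finitely many orbits and is $\mathbf{V}$-smooth). *)

(* Defs.v *)
From HB Require Import structures.
From mathcomp Require Import all_boot all_order all_algebra finfield.
From mathcomp Require Import boolp classical_sets cardinality fsbigop.
From mathcomp.multinomials Require Import freeg mpoly.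
From mathcomp Require Import ring.

Set Implicit Arguments.
Unset Strict Implicit.
Unset Printing Implicit Defensive.

Import GRing.Theory.
Local Open Scope ring_scope.
Local Open Scope quotient_scope.

(* The library builds ring quotients only by proper ideals; the quotient R/(f)  *)
(* below may be the zero ring.                                                *)
Section PrincipalQuotient.
Variables (R : comPzRingType) (f : R).

Definition principal_ideal : {pred R} := [pred x | `[< exists a, x = a * f >]].

Lemma principal_idealP x : reflect (exists a, x = a * f) (x \in principal_ideal).
Proof. exact: asboolP. Qed.

Fact principal_ideal_zmod_closed : zmod_closed principal_ideal.
Proof.
split; first by apply/principal_idealP; exists 0; rewrite mul0r.
move=> _ _ /principal_idealP[a ->] /principal_idealP[b ->].
by apply/principal_idealP; exists (a - b); rewrite mulrBl.
Qed.
HB.instance Definition _ :=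
  GRing.isZmodClosed.Build R principal_ideal principal_ideal_zmod_closed.

Lemma principal_idealMl a x : x \in principal_ideal -> a * x \in principal_ideal.
Proof.
by move=> /principal_idealP[b ->]; apply/principal_idealP; exists (a * b); rewrite mulrA.
Qed.

Definition quot_by := Quotient.quot principal_ideal.
HB.instance Definition _ := GRing.Zmodule.on quot_by.
HB.instance Definition _ := EqQuotient.on quot_by.

Definition quot_by_pi (x : R) : quot_by := \pi_quot_by x.
Definition quot_by_mul (x y : quot_by) : quot_by := quot_by_pi (repr x * repr y).

Lemma quot_by_piP x y : (quot_by_pi x == quot_by_pi y) = (x - y \in principal_ideal).
Proof. by rewrite /quot_by_pi Quotient.idealrBE. Qed.

Lemma quot_by_piK x : quot_by_pi (repr x) = x.
Proof. exact: reprK. Qed.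

Fact quot_by_piM x y : quot_by_pi (x * y) = quot_by_mul (quot_by_pi x) (quot_by_pi y).
Proof.
apply/eqP; rewrite quot_by_piP.
set x' := repr _; set y' := repr _.
have -> : x * y - x' * y' = y * (x - x') + x' * (y - y') by ring.
by rewrite rpredD // principal_idealMl // -quot_by_piP quot_by_piK.
Qed.

Fact quot_by_piD : {morph quot_by_pi : x y / x + y}.
Proof. by move=> x y; rewrite /quot_by_pi raddfD. Qed.

Fact quot_by_mulA : associative quot_by_mul.
Proof.
move=> x y z; rewrite -(quot_by_piK x) -(quot_by_piK y) -(quot_by_piK z).
by rewrite -!quot_by_piM mulrA.
Qed.
Fact quot_by_mulC : commutative quot_by_mul.
Proof. by move=> x y; rewrite /quot_by_mul mulrC. Qed.
Fact quot_by_mul1 : left_id (quot_by_pi 1) quot_by_mul.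
Proof. by move=> x; rewrite -(quot_by_piK x) -quot_by_piM mul1r. Qed.
Fact quot_by_mulDl : left_distributive quot_by_mul +%R.
Proof.
move=> x y z; rewrite -(quot_by_piK x) -(quot_by_piK y) -(quot_by_piK z).
by rewrite -quot_by_piD -!quot_by_piM -quot_by_piD mulrDl.
Qed.

HB.instance Definition _ := GRing.Zmodule_isComPzRing.Build quot_by
  quot_by_mulA quot_by_mulC quot_by_mul1 quot_by_mulDl.

HB.instance Definition _ := GRing.isZmodMorphism.Build R quot_by quot_by_pi
  (raddfB \pi_quot_by).
HB.instance Definition _ := GRing.isMonoidMorphism.Build R quot_by quot_by_pi
  (erefl, quot_by_piM).

End PrincipalQuotient.

(* R[1/s]: localization_frac a m stands for a / s^m. *)
Section Localization.
Variables (R : comPzRingType) (s : R).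

Definition loc_equiv (x y : R * nat) : bool :=
  `[< exists k, s ^+ k * (x.1 * s ^+ y.2 - y.1 * s ^+ x.2) = 0 >].

Fact loc_equiv_is_equiv : equiv_class_of loc_equiv.
Proof.
split=> [x|x y|y x z].
- by apply/asboolP; exists 0; rewrite subrr mulr0.
- by apply/asboolP/asboolP=> -[k e]; exists k; rewrite -opprB mulrN e oppr0.
move=> /asboolP[k e] /asboolP[l e']; apply/asboolP; exists (k + l + y.2)%N.
rewrite !exprD.
transitivity (s ^+ l * s ^+ z.2 * (s ^+ k * (x.1 * s ^+ y.2 - y.1 * s ^+ x.2))
  + s ^+ k * s ^+ x.2 * (s ^+ l * (y.1 * s ^+ z.2 - z.1 * s ^+ y.2))); first by ring.
by rewrite e e' !mulr0 addr0.
Qed.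

Canonical loc_equiv_equiv := EquivRelPack loc_equiv_is_equiv.
Canonical loc_equiv_encModRel := defaultEncModRel loc_equiv.

Definition localization := {eq_quot loc_equiv}.
HB.instance Definition _ := EqQuotient.on localization.
HB.instance Definition _ := Choice.on localization.

Definition localization_frac (a : R) (m : nat) : localization := \pi_localization (a, m).

Lemma localization_fracP a m b n :
  localization_frac a m = localization_frac b n <-> exists k, s ^+ k * (a * s ^+ n - b * s ^+ m) = 0.
Proof.
split=> [/eqP|e]; last by apply/eqP; rewrite /localization_frac eqmodE; apply/asboolP.
by rewrite /localization_frac eqmodE => /asboolP.
Qed.

Lemma localization_fracE x : x = localization_frac (repr x).1 (repr x).2.
Proof. by rewrite /localization_frac -surjective_pairing reprK. Qed.

Definition loc_add (x y : localization) := localization_frac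
  ((repr x).1 * s ^+ (repr y).2 + (repr y).1 * s ^+ (repr x).2) ((repr x).2 + (repr y).2).
Definition loc_opp (x : localization) := localization_frac (- (repr x).1) (repr x).2.
Definition loc_mul (x y : localization) :=
  localization_frac ((repr x).1 * (repr y).1) ((repr x).2 + (repr y).2).

Lemma localization_fracD a m b n : loc_add (localization_frac a m) (localization_frac b n) =
  localization_frac (a * s ^+ n + b * s ^+ m) (m + n).
Proof.
rewrite /loc_add; move: (localization_fracE (localization_frac a m)) (localization_fracE (localization_frac b n)).
case: (repr (localization_frac a m)) (repr (localization_frac b n)) => [a' m'] [b' n'] /=.
move=> /localization_fracP[k e] /localization_fracP[l e']; apply/localization_fracP; exists (k + l)%N.
rewrite !exprD.
transitivity (- s ^+ n * s ^+ n' * s ^+ l * (s ^+ k * (a * s ^+ m' - a' * s ^+ m))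
  - s ^+ m * s ^+ m' * s ^+ k * (s ^+ l * (b * s ^+ n' - b' * s ^+ n))); first by ring.
by rewrite e e' !mulr0 subr0.
Qed.

Lemma localization_fracN a m : loc_opp (localization_frac a m) = localization_frac (- a) m.
Proof.
rewrite /loc_opp; move: (localization_fracE (localization_frac a m)).
case: (repr (localization_frac a m)) => [a' m'] /= /localization_fracP[k e]; apply/localization_fracP; exists k.
by rewrite -[RHS]e; ring.
Qed.

Lemma localization_fracM a m b n :
  loc_mul (localization_frac a m) (localization_frac b n) = localization_frac (a * b) (m + n).
Proof.
rewrite /loc_mul; move: (localization_fracE (localization_frac a m)) (localization_fracE (localization_frac b n)).
case: (repr (localization_frac a m)) (repr (localization_frac b n)) => [a' m'] [b' n'] /=.
move=> /localization_fracP[k e] /localization_fracP[l e']; apply/localization_fracP; exists (k + l)%N.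
rewrite !exprD.
transitivity (- b * s ^+ n' * s ^+ l * (s ^+ k * (a * s ^+ m' - a' * s ^+ m))
  - a' * s ^+ m * s ^+ k * (s ^+ l * (b * s ^+ n' - b' * s ^+ n))); first by ring.
by rewrite e e' !mulr0 subr0.
Qed.

Fact loc_addA : associative loc_add.
Proof.
move=> x y z; rewrite (localization_fracE x) (localization_fracE y) (localization_fracE z) !localization_fracD.
by rewrite addnA !exprD; congr localization_frac; ring.
Qed.
Fact loc_addC : commutative loc_add.
Proof. by move=> x y; rewrite /loc_add addnC addrC. Qed.
Fact loc_add0 : left_id (localization_frac 0 0) loc_add.
Proof. by move=> x; rewrite (localization_fracE x) localization_fracD mul0r add0r mulr1. Qed.
Fact loc_addN : left_inverse (localization_frac 0 0) loc_opp loc_add.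
Proof.
move=> x; rewrite (localization_fracE x) localization_fracN localization_fracD mulNr addNr.
by apply/localization_fracP; exists 0; rewrite !mul0r subrr mulr0.
Qed.

HB.instance Definition _ :=
  GRing.isZmodule.Build localization loc_addA loc_addC loc_add0 loc_addN.

Fact loc_mulA : associative loc_mul.
Proof.
move=> x y z; rewrite (localization_fracE x) (localization_fracE y) (localization_fracE z) !localization_fracM.
by rewrite addnA mulrA.
Qed.
Fact loc_mulC : commutative loc_mul.
Proof. by move=> x y; rewrite /loc_mul addnC mulrC. Qed.
Fact loc_mul1 : left_id (localization_frac 1 0) loc_mul.
Proof. by move=> x; rewrite (localization_fracE x) localization_fracM mul1r. Qed.
Fact loc_mulDl : left_distributive loc_mul +%R.
Proof.
move=> x y z; rewrite (localization_fracE x) (localization_fracE y) (localization_fracE z).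
rewrite [_ + _]localization_fracD !localization_fracM [RHS]localization_fracD; apply/localization_fracP; exists 0.
by rewrite !exprD; ring.
Qed.

HB.instance Definition _ := GRing.Zmodule_isComPzRing.Build localization
  loc_mulA loc_mulC loc_mul1 loc_mulDl.

Definition localization_in (a : R) : localization := localization_frac a 0.

Fact loc_in_additive : zmod_morphism localization_in.
Proof. 
move=> a b; rewrite -[RHS]/(loc_add (localization_frac a 0) (loc_opp (localization_frac b 0))).
by rewrite localization_fracN localization_fracD !mulr1.
Qed.
Fact loc_in_multiplicative : monoid_morphism localization_in.
Proof.
by split=> // a b; rewrite -[RHS]/(loc_mul (localization_frac a 0) (localization_frac b 0)) localization_fracM.
Qed.
HB.instance Definition _ := GRing.isZmodMorphism.Build R localization localization_in loc_in_additive.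
HB.instance Definition _ := GRing.isMonoidMorphism.Build R localization localization_in loc_in_multiplicative.

End Localization.

(* Z[1/n], as a subring of rat. *)
Section Zinv.
Variable n : nat.

Definition Zinv_pred : {pred rat} :=
  [pred x | `[< exists k, n%:R ^+ k * x \is a Num.int >]].

Fact Zinv_subring_closed : subring_closed Zinv_pred.
Proof.
split.
- by apply/asboolP; exists 0; rewrite mulr1 rpred1.
- move=> x y /asboolP[k e] /asboolP[l e']; apply/asboolP; exists (k + l)%N.
  rewrite exprD.
  have -> : n%:R ^+ k * n%:R ^+ l * (x - y) =
    n%:R ^+ l * (n%:R ^+ k * x) - n%:R ^+ k * (n%:R ^+ l * y) by ring.
  by rewrite rpredB // rpredM // rpredX // rpred_nat.
move=> x y /asboolP[k e] /asboolP[l e']; apply/asboolP; exists (k + l)%N.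
by rewrite exprD mulrACA rpredM.
Qed.
HB.instance Definition _ := GRing.isSubringClosed.Build rat Zinv_pred Zinv_subring_closed.

Record Zinv := MkZinv { Zinv_val : rat; Zinv_valP : Zinv_val \in Zinv_pred }.
HB.instance Definition _ := [isSub for Zinv_val].
HB.instance Definition _ := [Choice of Zinv by <:].
HB.instance Definition _ := [SubChoice_isSubComNzRing of Zinv by <:].

Definition Zinv_unit : pred Zinv := fun x => (val x != 0) && ((val x)^-1 \in Zinv_pred).
Definition Zinv_inv (x : Zinv) : Zinv := if Zinv_unit x then insubd x (val x)^-1 else x.

Fact Zinv_mulVx : {in Zinv_unit, left_inverse 1 Zinv_inv *%R}.
Proof.
move=> x ux; have ux' : Zinv_unit x by [].
have /andP[x0 xV] := ux'; apply: val_inj.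
by rewrite /Zinv_inv ux' rmorphM rmorph1 /= insubdK // mulVf.
Qed.
Fact Zinv_unitPl (x y : Zinv) : y * x = 1 -> Zinv_unit x.
Proof.
move=> /(congr1 val); rewrite rmorphM rmorph1 /= => e.
have x0 : val x != 0 by apply: contra_eq_neq e => ->; rewrite mulr0 eq_sym oner_eq0.
by rewrite /Zinv_unit x0 /= -[(val x)^-1]mul1r -e mulfK // (valP y).
Qed.
Fact Zinv_invr_out : {in [predC Zinv_unit], Zinv_inv =1 id}.
Proof.
move=> x nux; have /negbTE nux' : ~~ Zinv_unit x by [].
by rewrite /Zinv_inv nux'.
Qed.
HB.instance Definition _ := GRing.ComNzRing_hasMulInverse.Build Zinv
  Zinv_mulVx Zinv_unitPl Zinv_invr_out.

End Zinv.

Lemma Zinv_half_unit q : (0 < q)%N -> (2%:R : Zinv (2 * q)) \is a GRing.unit.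
Proof.
move=> q0; apply/andP; rewrite rmorph_nat; split=> //; apply/asboolP; exists 1%N.
by rewrite expr1 natrM mulrAC divff // mul1r rpred_nat.
Qed.

Record gset (G : groupType) := Gset {
  gset_car :> choiceType;
  gact : G -> gset_car -> gset_car;
  gact1 : forall x, gact 1%g x = x;
  gactM : forall g h x, gact (g * h)%g x = gact g (gact h x)
}.
Arguments gact {G S} : rename.

Section GSets.
Variable G : groupType.
Implicit Types S T U : gset G.

Definition equivariant S T (f : S -> T) := forall g x, f (gact g x) = gact g (f x).
Definition gset_iso S T := exists2 f : S -> T, bijective f & equivariant f.

Definition same_orbit S (x y : S) : bool := `[< exists g, y = gact g x >].
Definition gtransitive S := (exists x : S, True) /\ forall x y : S, same_orbit x y.

Lemma gactK S (g : G) : cancel (@gact G S g) (gact g^-1%g).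
Proof. by move=> x; rewrite -gactM mulVg gact1. Qed.
Lemma gactKV S (g : G) : cancel (@gact G S g^-1%g) (gact g).
Proof. by move=> x; rewrite -gactM mulgV gact1. Qed.

Fact same_orbit_is_equiv S : equiv_class_of (@same_orbit S).
Proof.
split=> [x|x y|y x z].
- by apply/asboolP; exists 1%g; rewrite gact1.
- by apply/asboolP/asboolP=> -[g ->]; exists g^-1%g; rewrite gactK.
move=> /asboolP[g ->] /asboolP[h ->]; apply/asboolP.
by exists (h * g)%g; rewrite gactM.
Qed.
Canonical same_orbit_equiv S := EquivRelPack (@same_orbit_is_equiv S).
Canonical same_orbit_encModRel S := defaultEncModRel (@same_orbit S).

Definition orbits S := {eq_quot (@same_orbit S)}.
HB.instance Definition _ S := EqQuotient.on (orbits S).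
HB.instance Definition _ S := Choice.on (orbits S).

Lemma orbitsP S (x y : S) :
  reflect (exists g, y = gact g x) (\pi_(orbits S) x == \pi_(orbits S) y).
Proof. by rewrite eqmodE; apply: asboolP. Qed.

Definition gset_prod S T : gset G.
Proof.
refine (@Gset G (S * T)%type (fun g p => (gact g p.1, gact g p.2)) _ _).
- by move=> [x y]; rewrite !gact1.
- by move=> g h [x y]; rewrite !gactM.
Defined.

Definition gset_unit : gset G :=
  @Gset G unit (fun _ x => x) (fun=> erefl) (fun _ _ _ => erefl).

Section Orbit.
Variables (S : gset G) (x : S).
Record orbit_car := OrbitCar { orbit_val : S; orbit_valP : same_orbit x orbit_val }.
HB.instance Definition _ := [isSub for orbit_val].
HB.instance Definition _ := [Choice of orbit_car by <:].

Fact orbit_act_subproof (g : G) (y : orbit_car) : same_orbit x (gact g (val y)).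
Proof.
case: y => y /= /asboolP[h ->]; apply/asboolP.
by exists (g * h)%g; rewrite gactM.
Qed.
Definition orbit_act g y := OrbitCar (orbit_act_subproof g y).
Definition gset_orbit : gset G.
Proof.
refine (@Gset G orbit_car orbit_act _ _).
- by move=> y; apply: val_inj; rewrite /= gact1.
- by move=> g h y; apply: val_inj; rewrite /= gactM.
Defined.

Lemma gset_orbit_trans : gtransitive gset_orbit.
Proof.
have xx : same_orbit x x by apply/asboolP; exists 1%g; rewrite gact1.
split; first by exists (OrbitCar xx).
move=> [y hy] [z hz]; apply/asboolP.
have /asboolP[g gE] : same_orbit y z.
  have /asboolP[g ->] := hy; have /asboolP[h ->] := hz; apply/asboolP.
  by exists (h * g^-1)%g; rewrite gactM gactK.
by exists g; apply: val_inj.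
Qed.
End Orbit.

Definition stab S (x : S) : set G := [set g | gact g x = x]%classic.

(* On transitive G-sets, the set of point stabilizers is a complete           *)
(* isomorphism invariant (stabs_iso).                                         *)
Definition stabs S : set (set G) := [set stab x | x in [set: S]]%classic.

Lemma stab_inj S T (f : S -> T) x :
  injective f -> equivariant f -> stab (f x) = stab x.
Proof.
move=> fI fE; rewrite /stab predeqE => g /=; rewrite -fE.
by split=> [/fI|->].
Qed.

Lemma stabs_iso S T : gtransitive S -> gtransitive T ->
  gset_iso S T <-> stabs S = stabs T.
Proof.
move=> [[x0 _] St] [[y0 _] Tt]; split=> [[f fB fE]|e].
  rewrite predeqE => H; split=> -[].
    by move=> x _ <-; exists (f x) => //; rewrite stab_inj //; apply: bij_inj.
  case: fB => f' f'K fK y _ <-; exists (f' y) => //.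
  by rewrite -[in RHS](fK y) (@stab_inj _ _ f) //; apply: can_inj f'K.
have [y _ yE] : stabs T (stab x0) by rewrite -e; exists x0.
pose ok (x : S) (z : T) := exists2 g, x = gact g x0 & z = gact g y.
have stE g h : gact g x0 = gact h x0 <-> gact g y = gact h y.
  have /(_ (h^-1 * g)%g) : forall k, stab y k <-> stab x0 k by rewrite yE.
  rewrite /stab /= !gactM => e'; split=> e1.
    by rewrite -[LHS](gactKV h) (e'.2 _) // e1 gactK.
  by rewrite -[LHS](gactKV h) (e'.1 _) // e1 gactK.
have /choice[f fP] : forall x, exists z, ok x z.
  move=> x; have /asboolP[g ->] := St x0 x; by exists (gact g y), g.
have /choice[f' f'P] : forall z, exists x, ok x z.
  move=> z; have /asboolP[g ->] := Tt y z; by exists (gact g x0), g.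
have okP x x' z z' : ok x z -> ok x' z' -> x = x' <-> z = z'.
  by move=> [g -> ->] [h -> ->].
exists f.
  exists f' => [x|z]; first exact/(okP _ _ _ _ (f'P _) (fP x)).
  exact/(okP _ _ _ _ (fP _) (f'P z)).
move=> g x; apply/(okP _ _ _ _ (fP _) _); last exact: erefl.
by have [h xE ->] := fP x; exists (g * h)%g; rewrite gactM // -xE.
Qed.

End GSets.

Section Smooth.
Variables (G : groupType) (Om : gset G).

(* Every stabilizer is the pointwise stabilizer of a finite subset of Om. *)
Definition smooth (S : gset G) := forall x : S, exists A : seq Om,
  forall g, gact g x = x <-> {in A, forall v, gact g v = v}.

Definition oligomorphic := forall n, exists s : seq (n.-tuple Om),
  forall t : n.-tuple Om, exists2 u, u \in s & exists g, t = map_tuple (gact g) u.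

Lemma smooth_prod S T : smooth S -> smooth T -> smooth (gset_prod S T).
Proof.
move=> Ss Ts [x y]; have [A AP] := Ss x; have [B BP] := Ts y.
exists (A ++ B) => g; split=> [[/AP eA /BP eB] v|e].
  by rewrite mem_cat => /orP[/eA|/eB].
by congr (_, _); [apply/AP|apply/BP] => v vA; apply: e; rewrite mem_cat vA ?orbT.
Qed.

Lemma smooth_unit : smooth (gset_unit G).
Proof. by move=> []; exists [::] => g; split. Qed.

Lemma smooth_orbit (S : gset G) (x : S) : smooth S -> smooth (gset_orbit x).
Proof.
move=> Ss [y hy]; have [A AP] := Ss y; exists A => g; rewrite -AP.
by split=> [/(congr1 val)//|e]; apply: val_inj.
Qed.
End Smooth.

Record oligoGroup := OligoGroup {
  oligo_grp : groupType;
  oligo_dom : gset oligo_grp;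
  oligo_fin : oligomorphic oligo_dom
}.

Section Burnside.
Variable P : oligoGroup.
Local Notation G := (oligo_grp P).
Local Notation Om := (oligo_dom P).
Implicit Types S T U : gset G.

(* Isomorphism classes of transitive smooth G-sets. The type of all  *)
(* G-sets is too large to be a choiceType and to be quotiented, so the class  *)
(* of S is encoded by its invariant stabs S: class_repK and class_ofP say that *)
(* class_of is onto and identifies exactly the isomorphic G-sets.             *)
Definition is_class (C : set (set G)) : bool :=
  `[< exists2 S : gset G, gtransitive S /\ smooth Om S & C = stabs S >].
Record iso_class := IsoClass { iso_class_val : set (set G); _ : is_class iso_class_val }.
HB.instance Definition _ := [isSub for iso_class_val].
HB.instance Definition _ := [Choice of iso_class by <:].

Record sgset := SGset { sgset_car :> gset G; sgsetP : smooth Om sgset_car }.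

Fact class_of_subproof (S : sgset) : gtransitive S -> is_class (stabs S).
Proof. by move=> St; apply/asboolP; exists S => //; split=> //; apply: sgsetP. Qed.
Definition class_of (S : sgset) (St : gtransitive S) : iso_class :=
  IsoClass (class_of_subproof St).

Lemma class_ofP (S T : sgset) (St : gtransitive S) (Tt : gtransitive T) :
  class_of St = class_of Tt <-> gset_iso S T.
Proof.
by rewrite (stabs_iso St Tt); split=> [/(congr1 val)|e] //; apply: val_inj.
Qed.

Fact class_rep_subproof (c : iso_class) :
  exists S : sgset, exists St : gtransitive S, class_of St = c.
Proof.
case: c => C hC; have /asboolP[S [St Ss] CE] := hC.
by exists (SGset Ss), St; apply: val_inj.
Qed.
Definition class_rep (c : iso_class) : sgset := projT1 (cid (class_rep_subproof c)).
Lemma class_rep_trans c : gtransitive (class_rep c).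
Proof. by rewrite /class_rep; case: cid => S /= [St _]. Qed.
Lemma class_repK c : class_of (class_rep_trans c) = c.
Proof.
move: (class_rep_trans c); rewrite /class_rep; case: cid => S /= [St <-] St'.
exact: val_inj.
Qed.

Definition sgset_prod (S T : sgset) : sgset := SGset (smooth_prod (@sgsetP S) (@sgsetP T)).
Definition sgset_unit : sgset := SGset (smooth_unit Om).
Definition sgset_orbit (S : sgset) (x : S) : sgset := SGset (@smooth_orbit _ _ _ x (@sgsetP S)).
Definition orbit_class (S : sgset) (x : S) : iso_class :=
  @class_of (sgset_orbit x) (@gset_orbit_trans _ _ x).

Definition burnside := {freeg iso_class / int}.
HB.instance Definition _ := GRing.Lmodule.on burnside.

Definition burnside_basis (c : iso_class) : burnside := << 1 *g c >>.

(* The sum over the orbits of S of their classes; it is 0 by convention when  *)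
(* there are infinitely many orbits.                                          *)
Definition burnside_class (S : sgset) : burnside :=
  (\sum_(o \in [set: orbits S]) burnside_basis (orbit_class (repr o)))%classic.

(* The bilinear extension of the Cartesian product, see burnside_classM. *)
Definition burnside_mul (a b : burnside) : burnside :=
  \sum_(c <- dom a) \sum_(d <- dom b)
    (coeff c a * coeff d b) *: burnside_class (sgset_prod (class_rep c) (class_rep d)).

Definition transversal (S : sgset) (s : seq S) :=
  uniq [seq \pi_(orbits S) x | x <- s] /\
  forall x : S, exists2 y, y \in s & same_orbit y x.

Definition finite_orbits S := exists s : seq S, forall x : S, exists2 y, y \in s & same_orbit y x.

Lemma transversal_exists (S : sgset) : finite_orbits S -> exists s : seq S, transversal s.
Proof.
move=> [s sP]; exists [seq repr o | o <- undup [seq \pi_(orbits S) x | x <- s]].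
split.
  rewrite -map_comp (_ : map _ _ = undup [seq \pi_(orbits S) x | x <- s]) ?undup_uniq //.
  by rewrite -[RHS]map_id; apply: eq_map => o /=; rewrite reprK.
move=> x; have [y ys xy] := sP x; exists (repr (\pi_(orbits S) y)).
  by apply: map_f; rewrite mem_undup map_f.
by have : \pi_(orbits S) y = \pi_(orbits S) x;
  [apply/eqP; rewrite eqmodE | move=> ->; rewrite -eqmodE reprK].
Qed.

Lemma stab_orbit S (x : S) (z : gset_orbit x) : stab z = stab (val z).
Proof. by symmetry; apply: (@stab_inj _ _ S _ z val_inj). Qed.

Lemma orbit_class_inj (S T : sgset) (f : S -> T) x :
  injective f -> equivariant f -> orbit_class (f x) = orbit_class x.
Proof.
move=> fI fE; apply: val_inj; rewrite /= predeqE => H; split=> -[y _ <-].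
  case: y => y hy; have /asboolP[g yE] := hy.
  have hx : same_orbit x (gact g x) by apply/asboolP; exists g.
  exists (OrbitCar hx) => //.
  by rewrite !stab_orbit /= yE -fE (@stab_inj _ _ _ f).
case: y => y hy; have /asboolP[g yE] := hy.
have hx : same_orbit (f x) (f y) by apply/asboolP; exists g; rewrite yE fE.
exists (OrbitCar hx) => //.
by rewrite !stab_orbit /= (@stab_inj _ _ _ f).
Qed.

Lemma orbit_class_same (S : sgset) (x y : S) :
  same_orbit x y -> orbit_class x = orbit_class y.
Proof.
move=> xy; apply/class_ofP => /=.
have xyE z : same_orbit x z = same_orbit y z.
  rewrite -!eqmodE; suff -> : \pi_(orbits S) x = \pi_(orbits S) y by [].
  by apply/eqP; rewrite eqmodE.
have h1 (z : orbit_car x) : same_orbit y (val z) by rewrite -xyE (valP z).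
have h2 (z : orbit_car y) : same_orbit x (val z) by rewrite xyE (valP z).
exists (fun z => OrbitCar (h1 z)); last by move=> g z; apply: val_inj.
by exists (fun z => OrbitCar (h2 z)) => z; apply: val_inj.
Qed.

Lemma burnside_classE (S : sgset) (s : seq S) : transversal s ->
  burnside_class S = \sum_(x <- s) burnside_basis (orbit_class x).
Proof.
move=> [us cs].
rewrite /burnside_class.
transitivity (\sum_(o <- [seq \pi_(orbits S) x | x <- s])
   burnside_basis (orbit_class (repr o))).
  rewrite [RHS]fsbig_seq //; apply: eq_fsbigl.
  rewrite predeqE => o; split=> // _.
  have [y ys /= yo] := cs (repr o); rewrite /= -[o]reprK.
  suff <- : \pi_(orbits S) y = \pi_(orbits S) (repr o) by apply: map_f.
  by apply/eqP; rewrite eqmodE.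
rewrite big_map; apply: eq_bigr => x _; congr burnside_basis.
by apply: orbit_class_same; rewrite -eqmodE reprK.
Qed.

Lemma uniq_map_inj (T1 T2 : eqType) (h : T1 -> T2) (s : seq T1) :
  uniq (map h s) -> {in s &, injective h}.
Proof.
elim: s => //= a s IH /andP[/mapP ha /IH hs] x y.
rewrite !inE => /predU1P[->|xs] /predU1P[->|ys] // e; last exact: hs.
  by case: ha; exists y.
by case: ha; exists x.
Qed.

Section Decomp.
Variables (S : sgset) (I : eqType) (L : seq I) (T : I -> sgset).
Variable f : forall i, T i -> S.
Hypothesis fI : forall i, i \in L -> injective (@f i).
Hypothesis fE : forall i, i \in L -> equivariant (@f i).
Hypothesis fd : forall i j, i \in L -> j \in L -> forall x y, f (i:=i) x = f (i:=j) y -> i = j.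
Hypothesis fS : forall x, exists2 i, i \in L & exists y, x = f (i:=i) y.
Hypothesis uL : uniq L.
Hypothesis fT : forall i, i \in L -> finite_orbits (T i).

Lemma transversal_decomp : exists t : forall i, seq (T i),
  (forall i, i \in L -> transversal (t i)) /\ transversal [seq f x | i <- L, x <- t i].
Proof.
have tE : forall i, exists t : seq (T i), i \in L -> transversal t.
  move=> i; have [iL|] := boolP (i \in L); last by exists [::].
  by have [t tP] := transversal_exists (fT iL); exists t.
pose t i := projT1 (cid (tE i)).
have tP i : i \in L -> transversal (t i) := projT2 (cid (tE i)).
exists t; split=> //; split; last first.
  move=> x; have [i iL [y ->]] := fS x.
  have [_ /(_ y)[z zt /asboolP[g ->]]] := tP i iL.
  exists (f z); last by apply/asboolP; exists g; rewrite fE.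
  by apply/allpairsPdep; exists i, z.
rewrite map_allpairs; apply: (@allpairs_uniq_dep _ (fun i => T i)) => //.
  by move=> i iL; have [/map_uniq] := tP i iL.
move=> _ _ /allpairsPdep[i [x [iL xt ->]]] /allpairsPdep[j [y [jL yt ->]]] /=.
move=> /eqP/orbitsP[g]; rewrite -fE // => e.
have ij := fd jL iL e; move: y yt e; rewrite {}ij => y yt /(fI iL) e.
congr Tagged; have [ut _] := tP i iL.
apply: (uniq_map_inj ut) => //; apply/eqP/orbitsP.
by exists g.
Qed.

Lemma burnside_class_decomp :
  burnside_class S = \sum_(i <- L) burnside_class (T i).
Proof.
have [t [tP tS]] := transversal_decomp.
rewrite (burnside_classE tS) big_allpairs_dep big_seq [RHS]big_seq.
apply: eq_bigr => i iL; rewrite (burnside_classE (tP i iL)).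
by apply: eq_bigr => x _; rewrite orbit_class_inj //; [apply: fI|apply: fE].
Qed.

Lemma finite_orbits_decomp : finite_orbits S.
Proof. by have [t [_ [_ tS]]] := transversal_decomp; eexists; apply: tS. Qed.
End Decomp.

Lemma gset_iso_sym S T : gset_iso S T -> gset_iso T S.
Proof.
move=> [f [f' fK f'K] fE]; exists f'; first by exists f.
by move=> g x; apply: (can_inj fK); rewrite fE !f'K.
Qed.

Lemma burnside_class_iso (S T : sgset) :
  gset_iso S T -> finite_orbits S -> burnside_class T = burnside_class S.
Proof.
move=> [f [f' fK f'K] fE] Sf.
rewrite (@burnside_class_decomp T unit [:: tt] (fun=> S) (fun=> f)) ?big_seq1 //.
- by move=> _ _; apply: can_inj fK.
- by case=> -[].
- by move=> x; exists tt => //; exists (f' x).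
Qed.

Lemma transitive_finite S : gtransitive S -> finite_orbits S.
Proof.
by move=> [[x _] tr]; exists [:: x] => y; exists x; rewrite ?mem_head.
Qed.

Lemma agree_stab S (x : S) (A : seq Om) g h :
  (forall k, gact k x = x <-> {in A, forall v, gact k v = v}) ->
  [seq gact g v | v <- A] = [seq gact h v | v <- A] -> gact g x = gact h x.
Proof.
move=> AP /eq_in_map e; rewrite -[LHS](gactKV h) -[gact h^-1%g _]gactM (AP (h^-1 * g)%g).2 // => v vA.
by rewrite gactM e // gactK.
Qed.

Lemma finite_prod_trans (S T : sgset) : gtransitive S -> gtransitive T ->
  finite_orbits (gset_prod S T).
Proof.
move=> [[x0 _] St] [[y0 _] Tt].
have [A AP] := @sgsetP S x0; have [B BP] := @sgsetP T y0.
have [L LP] := @oligo_fin P (size A + size B).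
pose cat2 g h := [seq gact g v | v <- A] ++ [seq gact h v | v <- B].
have Q (u : (size A + size B).-tuple Om) : exists p : S * T, forall g h, u = cat2 g h :> seq Om ->
    same_orbit (S := gset_prod S T) p (gact g x0, gact h y0).
  have [[g0 [h0 e0]]|no] := pselect (exists g h, u = cat2 g h :> seq Om); last first.
    by exists (x0, y0) => g h e; case: no; exists g, h.
  exists (gact g0 x0, gact h0 y0) => g h; rewrite e0 /cat2 => /eqP.
  rewrite eqseq_cat ?size_map // => /andP[/eqP eA /eqP eB].
  by rewrite (agree_stab AP eA) (agree_stab BP eB); apply/asboolP; exists 1%g; rewrite gact1.
have /choice[F FP] := Q; exists (map F L) => -[x y].
have /asboolP[g ->] := St x0 x; have /asboolP[h ->] := Tt y0 y.
have ts : size (cat2 g h) == (size A + size B)%N by rewrite size_cat !size_map.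
have [u uL [k uE]] := LP (Tuple ts); exists (F u); first exact: map_f.
have /(FP u)/asboolP[l lE] : u = cat2 (k^-1 * g)%g (k^-1 * h)%g :> seq Om.
  have -> : u = map_tuple (gact k^-1%g) (Tuple ts).
    by rewrite uE; apply: val_inj; rewrite /= -map_comp map_id_in // => v _ /=; rewrite gactK.
  by rewrite /= map_cat -!map_comp; congr (_ ++ _); apply: eq_map => v /=; rewrite gactM.
apply/asboolP; exists (k * l)%g; rewrite gactM -lE /=.
by rewrite -!gactM !mulgA !mulgV !mul1g.
Qed.

Section ProdDecomp.
Variables S T : sgset.
Hypotheses (Sf : finite_orbits S) (Tf : finite_orbits T).

Let SO (p : S * T) := sgset_prod (@sgset_orbit S p.1) (@sgset_orbit T p.2).
Let f (p : S * T) (q : SO p) : sgset_prod S T := (val q.1, val q.2).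

Lemma prod_decomp (s : seq S) (t : seq T) : transversal s -> transversal t ->
  finite_orbits (sgset_prod S T) /\
  burnside_class (sgset_prod S T) =
  \sum_(x <- s) \sum_(y <- t) burnside_class (sgset_prod (@sgset_orbit S x) (@sgset_orbit T y)).
Proof.
move=> [us ss] [ut st].
have fI p : injective (@f p).
  by move=> [x y] [x' y'] [/val_inj -> /val_inj ->].
have fE p : equivariant (@f p) by [].
have inj : {in [seq (x, y) | x <- s, y <- t] &, forall p q,
    forall x y, @f p x = @f q y -> p = q}.
  move=> _ _ /allpairsP[[x y] [/= xs yt ->]] /allpairsP[[x' y'] [/= xs' yt' ->]].
  move=> [[a xa] [b yb]] [[a' xa'] [b' yb']] /= [aE bE]; subst a' b'.
  congr (_, _).
    apply: (uniq_map_inj us) => //; apply/eqP; rewrite eqmodE.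
    rewrite -!eqmodE in xa xa' *; by rewrite (eqP xa) (eqP xa').
  apply: (uniq_map_inj ut) => //; apply/eqP; rewrite eqmodE.
  rewrite -!eqmodE in yb yb' *; by rewrite (eqP yb) (eqP yb').
have surj x : exists2 i, i \in [seq (x, y) | x <- s, y <- t] & exists y, x = @f i y.
  case: x => x y; have [x' xs' hx] := ss x; have [y' yt' hy] := st y.
  exists (x', y'); first by apply/allpairsP; exists (x', y').
  by exists (OrbitCar hx, OrbitCar hy).
have uL : uniq [seq (x, y) | x <- s, y <- t].
  apply: allpairs_uniq => [||[? ?] [? ?] _ _ [-> ->]] //; first exact: map_uniq us.
  exact: map_uniq ut.
have fin i : finite_orbits (SO i).
  by apply: finite_prod_trans; apply: gset_orbit_trans.
split.
  by apply: (finite_orbits_decomp (f := f) (L := [seq (x, y) | x <- s, y <- t])).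
by rewrite (burnside_class_decomp (f := f) (L := [seq (x, y) | x <- s, y <- t])) // big_allpairs.
Qed.
End ProdDecomp.

Lemma finite_prod (S T : sgset) :
  finite_orbits S -> finite_orbits T -> finite_orbits (gset_prod S T).
Proof.
move=> /transversal_exists[s sP] /transversal_exists[t tP].
by have [] := prod_decomp sP tP.
Qed.

Lemma prod_iso S T S' T' : gset_iso S S' -> gset_iso T T' ->
  gset_iso (gset_prod S T) (gset_prod S' T').
Proof.
move=> [f [f' fK f'K] fE] [h [h' hK h'K] hE].
exists (fun p => (f p.1, h p.2)); last by move=> g [x y] /=; rewrite fE hE.
by exists (fun p => (f' p.1, h' p.2)) => -[x y] /=; rewrite ?fK ?hK ?f'K ?h'K.
Qed.

Lemma gset_unit_trans : gtransitive sgset_unit.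
Proof. by split; [exists tt|move=> [] []; apply/asboolP; exists 1%g]. Qed.

Lemma burnside_ind (Q : burnside -> Prop) :
  (forall c, Q (burnside_basis c)) -> (forall a b, Q a -> Q b -> Q (a - b)) ->
  forall a, Q a.
Proof.
move=> Qb QB a.
have Qz : Q 0 by rewrite -(subrr (burnside_basis (class_of gset_unit_trans))); apply: QB.
have Qn x y : Q x -> Q y -> Q (x + y).
  by move=> Qx Qy; rewrite -[y]opprK -[- y]sub0r; apply: (QB) => //; apply: (QB).
rewrite -[a]freeg_sumE; elim: (dom a) => [|c l IH]; first by rewrite big_nil.
rewrite big_cons; apply: (Qn) => //.
have Qm n : Q (burnside_basis c *+ n).
  by elim: n => [|n IHn]; rewrite ?mulr0n // mulrS; apply: (Qn).
have -> : << coeff c a *g c >> = burnside_basis c *~ coeff c a.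
  by rewrite freegU_mulz intz.
by case: (coeff c a) => n; [|rewrite NegzE mulrNz -sub0r; apply: (QB)]; rewrite // -pmulrn.
Qed.

Lemma fgliftE (M : lmodType int) (f : iso_class -> M) (a : burnside) :
  fglift f a = \sum_(c <- dom a) coeff c a *: f c.
Proof.
rewrite -[in LHS](freeg_sumE a).
pose L : {additive {freeg iso_class / int} -> M} :=
  HB.pack (fglift f) (GRing.isZmodMorphism.Build _ _ (fglift f) (lift_is_additive f)).
rewrite -[fglift f]/(L : _ -> _) raddf_sum; apply: eq_bigr => c _.
exact: liftU.
Qed.

Let burnside_rep_prod c d := burnside_class (sgset_prod (class_rep c) (class_rep d)).

Lemma burnside_mulE a b : burnside_mul a b = fglift (fun c => fglift (burnside_rep_prod c) b) a.
Proof.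
rewrite fgliftE; apply: eq_bigr => c _; rewrite fgliftE scaler_sumr.
by apply: eq_bigr => d _; rewrite scalerA.
Qed.

Lemma burnside_mulC : commutative burnside_mul.
Proof.
move=> a b; rewrite /burnside_mul exchange_big /=; apply: eq_bigr => c _.
apply: eq_bigr => d _; rewrite mulrC; congr (_ *: _).
apply: burnside_class_iso; last first.
  by apply: finite_prod_trans; apply: class_rep_trans.
exists (fun p => (p.2, p.1)) => //.
by exists (fun p => (p.2, p.1)) => -[].
Qed.

Lemma burnside_mulBl a b c :
  burnside_mul (a - b) c = burnside_mul a c - burnside_mul b c.
Proof. by rewrite !burnside_mulE lift_is_additive. Qed.

Lemma burnside_mulBr c a b :
  burnside_mul c (a - b) = burnside_mul c a - burnside_mul c b.
Proof. by rewrite !(burnside_mulC c) burnside_mulBl. Qed.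

Lemma burnside_mulDl : left_distributive burnside_mul +%R.
Proof.
move=> a b c; rewrite -[b in LHS]opprK burnside_mulBl -[- b]sub0r burnside_mulBl.
by rewrite -(subrr 0) burnside_mulBl subrr sub0r opprK.
Qed.

Lemma burnside_mul_suml I (r : seq I) F b :
  burnside_mul (\sum_(i <- r) F i) b = \sum_(i <- r) burnside_mul (F i) b.
Proof.
elim: r => [|i r IH]; last by rewrite !big_cons burnside_mulDl IH.
by rewrite !big_nil; have := burnside_mulBl 0 0 b; rewrite !subrr.
Qed.

Lemma burnside_mul_sumr I (r : seq I) F b :
  burnside_mul b (\sum_(i <- r) F i) = \sum_(i <- r) burnside_mul b (F i).
Proof.
rewrite burnside_mulC burnside_mul_suml.
by apply: eq_bigr => i _; rewrite burnside_mulC.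
Qed.

Lemma burnside_mul_basis c d : burnside_mul (burnside_basis c) (burnside_basis d) = burnside_rep_prod c d.
Proof. by rewrite burnside_mulE !liftU !scale1r. Qed.

Lemma burnside_class_trans (S : sgset) (St : gtransitive S) :
  burnside_class S = burnside_basis (class_of St).
Proof.
have [[x _] tr] := St.
have tx : transversal [:: x] by split=> // y; exists x; rewrite ?mem_head.
rewrite (burnside_classE tx) big_seq1; congr burnside_basis; apply/class_ofP.
exists val; last by [].
have h y : same_orbit x y by apply: tr.
by exists (fun y => OrbitCar (h y)) => // y; apply: val_inj.
Qed.

Lemma burnside_class_rep c : burnside_class (class_rep c) = burnside_basis c.
Proof. by rewrite (burnside_class_trans (class_rep_trans c)) class_repK. Qed.

Theorem burnside_classM (S T : sgset) : finite_orbits S -> finite_orbits T ->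
  burnside_class (sgset_prod S T) = burnside_mul (burnside_class S) (burnside_class T).
Proof.
move=> /transversal_exists[s sP] /transversal_exists[t tP].
have [_ ->] := prod_decomp sP tP.
rewrite (burnside_classE sP) (burnside_classE tP) burnside_mul_suml.
apply: eq_bigr => x _; rewrite burnside_mul_sumr; apply: eq_bigr => y _.
rewrite burnside_mul_basis; apply: burnside_class_iso; last first.
  by apply: finite_prod_trans; apply: class_rep_trans.
have iso (U : sgset) (z : U) : gset_iso (class_rep (orbit_class z)) (sgset_orbit z).
  by apply/(@class_ofP _ (sgset_orbit z) (class_rep_trans _) (@gset_orbit_trans _ U z)); rewrite class_repK.
exact: prod_iso (iso _ _) (iso _ _).
Qed.

Lemma burnside_mulA : associative burnside_mul.
Proof.
elim/burnside_ind=> [c|a a' Ha Ha'] b d; last by rewrite !burnside_mulBl Ha Ha'.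
elim/burnside_ind: b => [b|a a' Ha Ha']; last first.
  by rewrite !(burnside_mulBl, burnside_mulBr) Ha Ha'.
elim/burnside_ind: d => [d|a a' Ha Ha']; last by rewrite !burnside_mulBr Ha Ha'.
have fin e : finite_orbits (class_rep e) by apply: transitive_finite; apply: class_rep_trans.
rewrite -!burnside_class_rep -!burnside_classM //; try exact: finite_prod.
apply: burnside_class_iso; last by do 2!apply: finite_prod => //.
exists (fun p => (p.1.1, (p.1.2, p.2))) => //.
by exists (fun p => ((p.1, p.2.1), p.2.2)) => [[[]]|[? []]].
Qed.

Definition burnside_one : burnside := burnside_class sgset_unit.

Lemma burnside_mul1 : left_id burnside_one burnside_mul.
Proof.
elim/burnside_ind=> [c|a b Ha Hb]; last by rewrite burnside_mulBr Ha Hb.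
have fc : finite_orbits (class_rep c) by apply: transitive_finite; apply: class_rep_trans.
rewrite -burnside_class_rep -burnside_classM //; last exact: transitive_finite gset_unit_trans.
apply: burnside_class_iso => //; exists (fun x => (tt, x)) => //.
by exists snd => // -[[]].
Qed.

Lemma burnside_one_neq0 : burnside_one != 0.
Proof.
rewrite /burnside_one (burnside_class_trans gset_unit_trans) /burnside_basis.
by rewrite freegU_eq0.
Qed.

HB.instance Definition _ := GRing.Zmodule_isComNzRing.Build burnside
  burnside_mulA burnside_mulC burnside_mul1 burnside_mulDl burnside_one_neq0.

End Burnside.

Record quadSpace (F : fieldType) := QuadSpace {
  quad_car :> lmodType F;
  quad_form : {symmetric quad_car}
}.

Section Isometries.
Variable F : fieldType.
Implicit Types U W : quadSpace F.
Local Notation form := (@quad_form F _).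

Definition preserves_form U W (f : U -> W) := forall x y, form (f x) (f y) = form x y.

Definition is_embedding U W (f : U -> W) := [/\ linear f, injective f & preserves_form f].

Record embedding U W := Embedding {
  embedding_fun :> U -> W; embedding_subproof : `[< is_embedding embedding_fun >] }.
HB.instance Definition _ U W := [isSub for @embedding_fun U W].
HB.instance Definition _ U W := [Choice of embedding U W by <:].

Lemma embeddingP U W (f : embedding U W) : is_embedding f.
Proof. by case: f => f /= /asboolP. Qed.
Lemma embedding_inj U W (f g : embedding U W) : f =1 g -> f = g.
Proof. by move=> e; apply/val_inj/funext. Qed.
Definition mk_embedding U W (f : U -> W) (h : is_embedding f) : embedding U W :=
  Embedding (asboolT h).

Lemma comp_is_embedding U W (X : quadSpace F) (g : W -> X) (f : U -> W) :
  is_embedding g -> is_embedding f -> is_embedding (g \o f).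
Proof.
move=> [gl gi gp] [fl fi fp]; split; first by move=> a x y /=; rewrite fl gl.
  exact: inj_comp.
by move=> x y /=; rewrite gp fp.
Qed.

Section Aut.
Variable W : quadSpace F.

Record isometries := Isometry {
  isometry_fun :> W -> W;
  isometry_subproof :
    `[< [/\ linear isometry_fun, bijective isometry_fun & preserves_form isometry_fun] >] }.
HB.instance Definition _ := [isSub for isometry_fun].
HB.instance Definition _ := [Choice of isometries by <:].

Lemma isometryP (g : isometries) : [/\ linear g, bijective g & preserves_form g].
Proof. by case: g => g /= /asboolP. Qed.
Lemma isometry_inj (f g : isometries) : f =1 g -> f = g.
Proof. by move=> e; apply/val_inj/funext. Qed.

Lemma isometry_embedding (g : isometries) : is_embedding g.
Proof. by have [gl gb gp] := isometryP g; split=> //; apply: bij_inj. Qed.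

Fact isometry_one_subproof : `[< [/\ linear (@id W), bijective (@id W) & preserves_form (@id W)] >].
Proof. by apply/asboolP; split=> //; exists id. Qed.
Definition isometry_one := Isometry isometry_one_subproof.

Fact isometry_mul_subproof (g h : isometries) :
  `[< [/\ linear (g \o h), bijective (g \o h) & preserves_form (g \o h)] >].
Proof.
have [gl gb gp] := isometryP g; have [hl hb hp] := isometryP h.
apply/asboolP; split; first by move=> a x y /=; rewrite hl gl.
  exact: bij_comp.
by move=> x y /=; rewrite gp hp.
Qed.
Definition isometry_mul g h := Isometry (isometry_mul_subproof g h).

Fact isometry_inv_subproof (g : isometries) : exists h : isometries, cancel g h /\ cancel h g.
Proof.
have [gl [h gh hg] gp] := isometryP g.
have hP : [/\ linear h, bijective h & preserves_form h].
  split; last by move=> x y; rewrite -gp !hg.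
    by move=> a x y; apply: (can_inj gh); rewrite gl !hg.
  by exists g.
by exists (Isometry (asboolT hP)).
Qed.
Definition isometry_inv g : isometries := projT1 (cid (isometry_inv_subproof g)).
Lemma isometry_invP (g : isometries) : cancel g (isometry_inv g) /\ cancel (isometry_inv g) g.
Proof. by rewrite /isometry_inv; case: cid. Qed.

Fact isometry_mulA : associative isometry_mul.
Proof. by move=> f g h; apply: isometry_inj. Qed.
Fact isometry_mul1 : left_id isometry_one isometry_mul.
Proof. by move=> f; apply: isometry_inj. Qed.
Fact isometry_mulr1 : right_id isometry_one isometry_mul.
Proof. by move=> f; apply: isometry_inj. Qed.
Fact isometry_mulV : left_inverse isometry_one isometry_inv isometry_mul.
Proof. by move=> f; apply: isometry_inj => x /=; rewrite (isometry_invP f).1. Qed.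
Fact isometry_mulrV : right_inverse isometry_one isometry_inv isometry_mul.
Proof. by move=> f; apply: isometry_inj => x /=; rewrite (isometry_invP f).2. Qed.
HB.instance Definition _ := isGroup.Build isometries
  isometry_mulA isometry_mul1 isometry_mulr1 isometry_mulV isometry_mulrV.

Definition natural_gset : gset isometries :=
  @Gset isometries W (fun g x => g x) (fun=> erefl) (fun _ _ _ => erefl).

Definition embedding_act U (g : isometries) (f : embedding U W) : embedding U W :=
  mk_embedding (comp_is_embedding (isometry_embedding g) (embeddingP f)).
Definition embedding_gset U : gset isometries.
Proof.
refine (@Gset isometries (embedding U W) (@embedding_act U) _ _).
- by move=> f; apply: embedding_inj.
- by move=> g h f; apply: embedding_inj.
Defined.

End Aut.
End Isometries.

Section DiagonalSpace.
Variables (F : fieldType) (k : nat) (d : 'rV[F]_k).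

Definition diag_form (x y : 'rV[F]_k) : F := \sum_(i < k) d 0 i * x 0 i * y 0 i.

Fact diag_form_bilinear : bilinear_for *%R (idfun \; *%R) diag_form.
Proof.
split=> [y|x] a u v; rewrite /diag_form /= mulr_sumr -big_split /=;
  by apply: eq_bigr => i _; rewrite !mxE; ring.
Qed.
HB.instance Definition _ := bilinear_isBilinear.Build F _ _ _ *%R (idfun \; *%R) diag_form
  diag_form_bilinear.
Fact diag_form_sym x y : diag_form x y = (-1) ^+ false * idfun (diag_form y x).
Proof. by rewrite mul1r; apply: eq_bigr => i _; rewrite mulrAC. Qed.
HB.instance Definition _ := isHermitianSesquilinear.Build F _ false idfun diag_form diag_form_sym.

Definition diag_space : quadSpace F := @QuadSpace F 'rV[F]_k diag_form.

Lemma embedding_smooth (W : quadSpace F) :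
  smooth (natural_gset W) (embedding_gset W diag_space).
Proof.
move=> f; exists [seq f (delta_mx 0 i) | i <- enum 'I_k] => g; split=> [e v|e].
  by move=> /mapP[i _ ->]; rewrite -{2}e.
have [gl _ _] := isometryP g; have [fl _ _] := embeddingP f.
pose L h (hl : linear h) : {linear diag_space -> W} :=
  HB.pack h (GRing.isLinear.Build _ _ _ _ h hl).
have gfl : linear (g \o f) by move=> a x y /=; rewrite fl gl.
apply: embedding_inj => x; rewrite -[LHS]/(L _ gfl x) -[RHS]/(L _ fl x).
rewrite [x]row_sum_delta !linear_sum; apply: eq_bigr => i _; rewrite !linearZ /=; congr (_ *: _).
by apply: e; apply/mapP; exists i; rewrite ?mem_enum.
Qed.
End DiagonalSpace.

Section Discriminants.
Variable F : fieldType.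

(* Gram matrix diag(1, ..., 1, (-1)^r delta) with r = m./2, so that the        *)
(* modified discriminant is delta (mod_disc_V). The class delta in            *)
(* F^x / (F^x)^2 is given by a representative, ignored when m = 0.            *)
Definition quadV_diag m (delta : F) : 'rV[F]_m :=
  \row_(i < m) (if (i.+1 == m)%N then (-1) ^+ m./2 * delta else 1).

Definition mod_disc m (d : 'rV[F]_m) : F := (-1) ^+ m./2 * \det (diag_mx d).

Lemma mod_disc_V m (delta : F) : (0 < m)%N -> mod_disc (quadV_diag m delta) = delta.
Proof.
case: m => // m _; rewrite /mod_disc det_diag big_ord_recr /= big1 => [|i _].
  by rewrite mxE eqxx mul1r mulrA -expr2 sqrr_sign mul1r.
by rewrite mxE /= eqSS ltn_eqF.
Qed.

(* The orthogonal sum of V_{m,delta} and of an n-dimensional null space. *)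
Definition quadV m (delta : F) n : quadSpace F :=
  diag_space (row_mx (quadV_diag m delta) (0 : 'rV_n)).
End Discriminants.

Section HyperbolicSpace.
Variable F : fieldType.
Local Notation V := ({poly F} * {poly F})%type.

Definition coef_pairing (p q : {poly F}) : F := \sum_(i < size p) p`_i * q`_i.

Lemma coef_pairingE N (p q : {poly F}) : (size p <= N)%N || (size q <= N)%N ->
  coef_pairing p q = \sum_(i < N) p`_i * q`_i.
Proof.
move=> h; rewrite /coef_pairing.
pose M := maxn N (size p).
have -> : \sum_(i < size p) p`_i * q`_i = \sum_(i < M) p`_i * q`_i.
  rewrite (big_ord_widen M (fun i => p`_i * q`_i)) ?leq_maxr // big_mkcond /=.
  by apply: eq_bigr => i _; case: ltnP => // le; rewrite nth_default // mul0r.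
rewrite [RHS](big_ord_widen M (fun i => p`_i * q`_i)) ?leq_maxl // [RHS]big_mkcond /=.
apply: eq_bigr => i _; case: ltnP => // le.
by case/orP: h => h; rewrite (nth_default _ (leq_trans h le)) (mul0r, mulr0).
Qed.

(* A pair (p, q) of polynomials stands for sum_i (p_i e_i + q_i f_i), the      *)
(* indices starting from 0 (hyp_form_basis).                                  *)
Definition hyp_form (x y : V) : F := coef_pairing x.1 y.2 + coef_pairing x.2 y.1.

Lemma hyp_formE N (x y : V) : (size y.1 <= N)%N -> (size y.2 <= N)%N ->
  hyp_form x y = \sum_(i < N) (x.1`_i * y.2`_i + x.2`_i * y.1`_i).
Proof. by move=> h1 h2; rewrite /hyp_form !(coef_pairingE (N:=N)) ?h1 ?h2 ?orbT // big_split. Qed.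

Fact hyp_form_symE x y : hyp_form x y = hyp_form y x.
Proof.
have e (p q : {poly F}) : coef_pairing p q = coef_pairing q p.
  rewrite (coef_pairingE (N:=size q)) ?leqnn ?orbT //.
  by apply: eq_bigr => i _; rewrite mulrC.
by rewrite /hyp_form addrC e [in X in _ + X]e.
Qed.

Fact hyp_form_bilinear : bilinear_for *%R (idfun \; *%R) hyp_form.
Proof.
have lin y : GRing.linear_for *%R (hyp_form ^~ y).
  move=> a u v; pose N := maxn (size y.1) (size y.2).
  rewrite !(hyp_formE (N := N)) ?leq_maxl ?leq_maxr // mulr_sumr -big_split.
  by apply: eq_bigr => i _; rewrite /= !coefD !coefZ; ring.
by split=> // x a u v; rewrite !(hyp_form_symE x) lin.
Qed.
HB.instance Definition _ := bilinear_isBilinear.Build F _ _ _ *%R (idfun \; *%R) hyp_form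
  hyp_form_bilinear.
Fact hyp_form_sym x y : hyp_form x y = (-1) ^+ false * idfun (hyp_form y x).
Proof. by rewrite mul1r hyp_form_symE. Qed.
HB.instance Definition _ := isHermitianSesquilinear.Build F _ false idfun hyp_form hyp_form_sym.

Definition hyp_space : quadSpace F := @QuadSpace F V hyp_form.

Definition hyp_e i : hyp_space := ('X^i, 0).
Definition hyp_f i : hyp_space := (0, 'X^i).

Lemma hyp_form_basis i j :
  [/\ quad_form hyp_space (hyp_e i) (hyp_e j) = 0,
      quad_form hyp_space (hyp_f i) (hyp_f j) = 0
    & quad_form hyp_space (hyp_e i) (hyp_f j) = (i == j)%:R].
Proof.
have p0 (p : {poly F}) : coef_pairing 0 p = 0 by rewrite /coef_pairing size_poly0 big_ord0.
have r0 (p : {poly F}) : coef_pairing p 0 = 0.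
  by rewrite /coef_pairing big1 // => k _; rewrite coef0 mulr0.
rewrite /quad_form /= /hyp_form /= !p0 !r0 !addr0; split=> //.
rewrite (coef_pairingE (N := i.+1)) ?size_polyXn ?leqnn // big_ord_recr /=.
rewrite big1 => [|k _]; last by rewrite coefXn ltn_eqF // mul0r.
by rewrite !coefXn eqxx mul1r add0r.
Qed.
End HyperbolicSpace.

Lemma odd_card_two_neq0 (F : finFieldType) : odd #|F| -> (2%:R : F) != 0.
Proof.
move=> oF; apply/negP => F2.
have F2c : (2 \in [pchar F])%N by rewrite inE /= F2.
have := finNzRing_gt1 F; rewrite (card_pprimeChar F2c).
by move: oF; rewrite (card_pprimeChar F2c) oddX orbF => /eqP ->.
Qed.

Section Reflections.
Variables (F : fieldType) (W : quadSpace F).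
Local Notation form := (@quad_form F W).

Lemma quad_formC x y : form x y = form y x.
Proof. by rewrite [LHS]hermitian_subproof mul1r. Qed.
Lemma quad_formDl x y z : form (x + y) z = form x z + form y z. Proof. exact: linearDl. Qed.
Lemma quad_formZl a x z : form (a *: x) z = a * form x z. Proof. exact: linearZl_LR. Qed.
Lemma quad_formBl x y z : form (x - y) z = form x z - form y z. Proof. exact: linearBl. Qed.
Lemma quad_formBr x y z : form z (x - y) = form z x - form z y. Proof. exact: linearBr. Qed.
Lemma quad_formZr a x z : form z (a *: x) = a * form z x.
Proof. by rewrite !(quad_formC z) quad_formZl. Qed.

Definition refl_fun u x : W := x - (2%:R * form x u / form u u) *: u.

Lemma refl_subproof u : form u u != 0 ->
  `[< [/\ linear (refl_fun u), bijective (refl_fun u) & preserves_form (refl_fun u)] >].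
Proof.
move=> u0; apply/asboolP; split.
- move=> a x y; rewrite /refl_fun quad_formDl quad_formZl mulrDr mulrDl scalerDl.
  rewrite scalerBr scalerA opprD addrACA; congr (_ + _ + _).
  by congr (- (_ *: _)); ring.
- exists (refl_fun u) => x; rewrite /refl_fun quad_formBl quad_formZl -addrA -opprD -scalerDl;
    rewrite [X in X *: u](_ : _ = 0) ?scale0r ?subr0 //; by field.
by move=> x y; rewrite /refl_fun !(quad_formBl, quad_formBr, quad_formZl, quad_formZr) (quad_formC u y); field.
Qed.

Lemma refl_swap x y : form x x = form y y -> form (x - y) (x - y) != 0 ->
  exists g : isometries W, g x = y /\ forall z, form z (x - y) = 0 -> g z = z.
Proof.
move=> e n0; exists (Isometry (refl_subproof n0)) => /=; split; last first.
  by move=> z z0; rewrite /refl_fun z0 mulr0 mul0r scale0r subr0.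
have E : form (x - y) (x - y) = 2%:R * form x (x - y).
  by rewrite !(quad_formBl, quad_formBr) (quad_formC y x) -e; ring.
by rewrite /refl_fun -E divff // scale1r opprB addrC subrK.
Qed.
End Reflections.

Section Hyperbolic.
Variable F : fieldType.
Hypothesis F2 : (2%:R : F) != 0.
Local Notation W := (hyp_space F).
Local Notation form := (@quad_form F W).
Local Notation G := (isometries W).

Definition in_hyp N (x : W) := (size x.1 <= N)%N && (size x.2 <= N)%N.
Definition hyp_low N (x : W) := forall i, (i < N)%N -> x.1`_i = 0 /\ x.2`_i = 0.

Lemma form_low N x y : in_hyp N x -> hyp_low N y -> form x y = 0.
Proof.
move=> /andP[x1 x2] yl; rewrite quad_formC -[LHS]/(hyp_form y x) (hyp_formE _ x1 x2) big1 // => i _.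
by have [-> ->] := yl i (ltn_ord i); rewrite !mul0r addr0.
Qed.

Definition hyp_conj N (x y : W) := exists2 g : G, forall z, in_hyp N z -> g z = z & g x = y.

Lemma hyp_conj_trans N x y z : hyp_conj N x y -> hyp_conj N y z -> hyp_conj N x z.
Proof.
move=> [g gf <-] [h hf <-]; exists (h * g)%g => // w wN /=.
by rewrite gf ?hf.
Qed.

Lemma hyp_conj_step N (x y : W) : hyp_low N x -> hyp_low N y -> form x x = form y y ->
  form (x - y) (x - y) != 0 -> hyp_conj N x y.
Proof.
move=> xl yl e n0; have [g [gx gz]] := refl_swap e n0.
exists g => // z zN; apply: gz; rewrite quad_formBr !(form_low zN) ?subrr //.
Qed.

Lemma hyp_conj_iso N (x y : W) : hyp_low N x -> hyp_low N y -> form x x = 0 -> form y y = 0 ->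
  form x y != 0 -> hyp_conj N x y.
Proof.
move=> xl yl x0 y0 xy; apply: hyp_conj_step; rewrite ?x0 ?y0 //.
rewrite !(quad_formBl, quad_formBr) x0 y0 (quad_formC y x) sub0r subr0 -opprD oppr_eq0.
by rewrite -mulr2n -mulr_natl mulf_neq0.
Qed.

Definition hyp_vec (a b : F) i : W := (a *: 'X^i, b *: 'X^i).

Lemma hyp_vec_low N a b i : (N <= i)%N -> hyp_low N (hyp_vec a b i).
Proof.
by move=> h j jN; rewrite /= !coefZ !coefXn !(ltn_eqF (leq_trans jN h)) !mulr0.
Qed.

Lemma in_hyp_vec N a b i : (i < N)%N -> in_hyp N (hyp_vec a b i).
Proof.
by move=> h; rewrite /in_hyp /= !(leq_trans (size_scale_leq _ _)) // size_polyXn.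
Qed.

Lemma form_hyp_vec x a b i : form x (hyp_vec a b i) = x.1`_i * b + x.2`_i * a.
Proof.
have /andP[h1 h2] := in_hyp_vec a b (ltnSn i).
rewrite -[LHS]/(hyp_form x (hyp_vec a b i)) (hyp_formE _ h1 h2) big_ord_recr big1 => [|j _] /=.
  by rewrite !coefZ !coefXn eqxx add0r !mulr1.
by rewrite !coefZ !coefXn ltn_eqF // !mulr0 addr0.
Qed.

Lemma form_hyp_vec2 a b c d i j :
  form (hyp_vec a b i) (hyp_vec c d j) = (a * d + b * c) * (i == j)%:R.
Proof. by rewrite form_hyp_vec /= !coefZ !coefXn eq_sym; ring. Qed.

Lemma hyp_conj_ee N i (a b : F) : (N <= i)%N -> a * b = 0 -> a * a + b * b != 0 ->
  exists y, in_hyp N.+1 y /\ hyp_conj N (hyp_vec a b i) y.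
Proof.
move=> Ni ab s0; pose u2 := hyp_vec b a i + hyp_vec b a N; pose y := hyp_vec a b N.
exists y; split; first exact: in_hyp_vec.
have l1 := hyp_vec_low a b Ni; have l2 := hyp_vec_low a b (leqnn N).
have l3 := hyp_vec_low b a Ni; have l4 := hyp_vec_low b a (leqnn N).
have l5 : hyp_low N u2.
  by move=> j jN; rewrite /= !coefD; have [-> ->] := l3 j jN; have [-> ->] := l4 j jN; rewrite addr0.
have ba : b * a = 0 by rewrite mulrC.
have two : 1 + 1 != 0 :> F by [].
have n1 : (1 + (i == N)%:R : F) != 0 by case: (i == N); rewrite ?addr0 ?oner_eq0.
have n2 : ((i == N)%:R + 1 : F) != 0 by rewrite addrC.
have formDr (p q r : W) : form r (p + q) = form r p + form r q.
  by rewrite !(quad_formC r) quad_formDl.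
have f11 : form (hyp_vec a b i) (hyp_vec a b i) = 0 by rewrite form_hyp_vec2 ab ba addr0 mul0r.
have f22 : form y y = 0 by rewrite form_hyp_vec2 ab ba addr0 mul0r.
have f33 : form u2 u2 = 0.
  by rewrite /u2 quad_formDl !formDr !form_hyp_vec2 ab ba addr0 !mul0r !addr0.
apply: (@hyp_conj_trans _ _ u2); apply: hyp_conj_iso => //.
  rewrite /u2 formDr !form_hyp_vec2 eqxx -mulrDr mulf_neq0 //.
rewrite /u2 quad_formDl !form_hyp_vec2 eqxx -mulrDr mulf_neq0 //.
by rewrite addrC.
Qed.

Lemma in_hypW N x : in_hyp N x -> in_hyp N.+1 x.
Proof. by case/andP=> h1 h2; rewrite /in_hyp !leqW. Qed.

Lemma in_hypD N x y : in_hyp N x -> in_hyp N y -> in_hyp N (x + y).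
Proof.
move=> /andP[h1 h2] /andP[h3 h4]; apply/andP; split;
  by apply: (leq_trans (size_polyD _ _)); rewrite geq_max ?h1 ?h2 ?h3 ?h4.
Qed.

Lemma hyp_conj_low N w : hyp_low N w -> exists y, in_hyp N.+1 y /\ hyp_conj N w y.
Proof.
move=> wl; pose q := form w w.
have [q0|q0] := eqVneq q 0; last first.
  pose c := q / 2%:R; pose M := maxn N.+1 (maxn (size w.1) (size w.2)).
  have NM : (N < M)%N by rewrite leq_maxl.
  exists (hyp_vec 1 c N); split; first exact: in_hyp_vec.
  have fM x : form (hyp_vec 1 c x) (hyp_vec 1 c x) = q.
    by rewrite form_hyp_vec2 eqxx mul1r !mulr1 /c; field.
  have wM : form w (hyp_vec 1 c M) = 0.
    rewrite form_hyp_vec !nth_default ?mul0r ?addr0 //.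
      by rewrite /M !leq_max leqnn !orbT.
    by rewrite /M !leq_max leqnn !orbT.
  have step x y : form x x = q -> form y y = q -> form x y = 0 -> form (x - y) (x - y) != 0.
    move=> xq yq xy; rewrite !(quad_formBl, quad_formBr) (quad_formC y x) xy xq yq subr0 sub0r opprK.
    by rewrite -mulr2n -mulr_natl mulf_neq0.
  have lM := hyp_vec_low 1 c (ltnW NM); have lN := hyp_vec_low 1 c (leqnn N).
  apply: (@hyp_conj_trans _ _ (hyp_vec 1 c M)); apply: hyp_conj_step => //; rewrite ?fM //.
    by apply: step; rewrite ?fM.
  by apply: step; rewrite ?fM // form_hyp_vec2 gtn_eqF // mulr0.
have [[i [a [b [Ni ab s0 wi]]]]|no] := pselect (exists i a b,
    [/\ (N <= i)%N, a * b = 0 :> F, a * a + b * b != 0 & form w (hyp_vec a b i) != 0]).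
  have [y [yN yc]] := hyp_conj_ee Ni ab s0; exists y; split=> //.
  apply: hyp_conj_trans yc; apply: hyp_conj_iso => //; first exact: hyp_vec_low.
  have ba : b * a = 0 by rewrite mulrC.
  by rewrite form_hyp_vec2 ab ba addr0 mul0r.
have w0 : w = 0.
  have z i : w.1`_i = 0 /\ w.2`_i = 0.
    have [/wl//|Ni] := ltnP i N.
    split; apply/eqP/negPn/negP => n0; apply: no.
      exists i, 0, 1; split=> //; rewrite ?mul0r ?add0r ?mulr1 ?oner_eq0 //.
      by rewrite form_hyp_vec mulr1 mulr0 addr0.
    exists i, 1, 0; split=> //; rewrite ?mulr0 ?addr0 ?mulr1 ?oner_eq0 //.
    by rewrite form_hyp_vec mulr1 mulr0 add0r.
  rewrite [w]surjective_pairing; congr (_, _); apply/polyP => i; rewrite coef0;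
    by have [] := z i.
exists w; split; first by rewrite w0 /in_hyp /= size_poly0.
by exists 1%g.
Qed.

Lemma tuple_to_hi n (t : n.-tuple W) : exists g : G, forall v, v \in t -> in_hyp n (g v).
Proof.
elim: n t => [|n IH] t; first by exists 1%g => v; rewrite tuple0.
case/tupleP: t => x t; have [g gP] := IH t.
pose h : W := (take_poly n (g x).1, take_poly n (g x).2).
have hn : in_hyp n h by rewrite /in_hyp /= !size_take_poly.
have wl : hyp_low n (g x - h).
  by move=> i ni; rewrite /= !coefB !coef_take_poly ni !subrr.
have [y [yN [k kf kx]]] := hyp_conj_low wl.
have [kl _ _] := isometryP k.
have kD p q : k (p + q) = k p + k q by have := kl 1 p q; rewrite !scale1r.
exists (k * g)%g => v; rewrite inE => /predU1P[->|vt].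
  have -> : (k * g)%g x = k (h + (g x - h)) by rewrite addrC subrK.
  by rewrite kD kx kf // in_hypD // in_hypW.
have -> : (k * g)%g v = k (g v) by [].
by rewrite kf ?in_hypW // gP.
Qed.

End Hyperbolic.

Lemma hyp_oligomorphic (F : finFieldType) :
  odd #|F| -> oligomorphic (natural_gset (hyp_space F)).
Proof.
move=> /odd_card_two_neq0 F2 n.
pose phi (p : n.-tuple F * n.-tuple F) : hyp_space F := (Poly p.1, Poly p.2).
exists [seq map_tuple phi u | u : n.-tuple (n.-tuple F * n.-tuple F)%type] => t.
have [g gP] := tuple_to_hi F2 t.
pose psi (x : hyp_space F) := ([tuple x.1`_i | i < n], [tuple x.2`_i | i < n]).
have psiK x : in_hyp n x -> phi (psi x) = x.
  have P (p : {poly F}) : (size p <= n)%N -> Poly [tuple p`_i | i < n] = p.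
    move=> sp; apply/polyP => i; rewrite coef_Poly.
    have [ni|ni] := leqP n i; first by rewrite !nth_default ?size_tuple ?(leq_trans sp).
    by rewrite -[i]/(val (Ordinal ni)) -tnth_nth tnth_mktuple.
  by case/andP=> h1 h2; rewrite /phi /psi /= !P // [RHS]surjective_pairing.
pose u : n.-tuple (n.-tuple F * n.-tuple F)%type := map_tuple (psi \o g) t.
exists (map_tuple phi u); first by apply: map_f; rewrite mem_enum.
exists g^-1%g; apply: val_inj; rewrite /= -!map_comp -[LHS]map_id.
apply/eq_in_map => v vt; rewrite /= psiK ?gP //.
by rewrite -[LHS](gactK (S := natural_gset _) g).
Qed.

(* The infinite orthogonal group, with its action on hyp_space F. *)
Definition orthogonal_group (F : finFieldType) (oddF : odd #|F|) : oligoGroup :=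
  OligoGroup (hyp_oligomorphic oddF).

Definition Xgset (F : finFieldType) (oddF : odd #|F|) m (delta : F) n :
    sgset (orthogonal_group oddF) :=
  @SGset (orthogonal_group oddF) (embedding_gset (hyp_space F) (quadV m delta n))
    (@embedding_smooth F _ _ (hyp_space F)).

Definition xclass (F : finFieldType) (oddF : odd #|F|) m (delta : F) n :
    burnside (orthogonal_group oddF) :=
  burnside_class (Xgset oddF m delta n).

(* Main.v *)
From HB Require Import structures.
From mathcomp Require Import boolp classical_sets.
From mathcomp Require Import all_boot all_order all_algebra.
From mathcomp.multinomials Require Import freeg mpoly.
From mathcomp Require Import ring.
Require Import Defs.

Set Implicit Arguments.
Unset Strict Implicit.
Unset Printing Implicit Defensive.

Import GRing.Theory.
Local Open Scope ring_scope.

(** Fix the field F, with q elements, and write [A] for the class in the Burnside ring of the set of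
frames with Gram matrix A, that is, of the embeddings into the hyperbolic space of the quadratic space
with Gram matrix A. By Witt's extension theorem ([frame_conj]) a set of frames is transitive; every
transitive smooth set is a set of frames ([burnside_basis_frame]); and two such sets are isomorphic
only if the Gram matrices are congruent ([frame_iso_congr]), because the pointwise stabilizer of a
finite-dimensional subspace fixes no vector outside it.

All computations rest on one product formula ([frame_class_mul]). A pair formed by a frame f and a
nonzero vector v of norm a either has v in the span of f, or is a longer frame, whose Gram matrix is
known from the pairings l of v with f. Hence [A][a] is a multiple of [A] plus the sum over all l of
the classes of the bordered matrices (A, l; l^T, a).

The relation. The product formula, used for lines only, expresses X^2, Y^2, XZ and YZ through binary
forms. Over a finite field nondegenerate binary forms with the same discriminant are congruent, so
everything cancels in twice the relation except degenerate planes, and these cancel too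
([formal_relation]).

Surjectivity. The class of a matrix is reached by induction on its size, and for each size by
decreasing rank ([frame_class_generated]). Split A as A' + <c>, and multiply [A'] by all lines <a>.
Bordered matrices with l outside the row space of A' have rank at least 2 more than A' and are known.
If l = u A' the bordered matrix is congruent to A' + <a - Q(u)>, where Q is the quadratic form of A'.
So for each a the sum over u of [A' + <a - Q(u)>] is known: the function b -> [A' + <b>] has to be
recovered from its convolution with the distribution of the values of -Q. Convolving with the
distribution of Q gives the distribution of the form Q(w) - Q(u), which after a linear change of
variables is a bilinear pairing; its values are uniformly distributed except for an additional mass at
0 that is a power of q. The uniform part only sees the sum of all [A' + <b>], which is known, and it
remains to divide by a power of q ([deconvolution]).

Injectivity. With D = X - Y, S = X + Y and H = 1 - X/2 - Y/2 + Z the relation reads HD = 0, so modulo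
the relation every polynomial is a combination of the D^m S^n and, for m > 0, the H^m S^n with m + n at
most some d ([poly_spanned]). The same indices label the spaces V_{m,1,n} and, for m > 0, V_{m,pi,n} of
dimension at most d, whose classes are different basis elements of the Burnside ring
([quad_class_inj]) and which, by the construction above, are images of such combinations with the same
bound d. Thus the images of the family span as many independent elements as the family has members,
and are therefore linearly independent ([eval_kernel]). *)

(** * Vectors of the hyperbolic space and Witt's theorem *)

Section HypGeometry.
Variable F : fieldType.
Hypothesis F2 : (2%:R : F) != 0.
Local Notation W := (hyp_space F).
Local Notation form := (@quad_form F W).
Local Notation G := (isometries W).

Definition linear_inj k (f : 'rV[F]_k -> W) := linear f /\ injective f.

Lemma linear_at0 (U V : lmodType F) (f : U -> V) : linear f -> f 0 = 0.
Proof. by move=> fl; have := fl (-1) 0 0; rewrite scaler0 add0r scaleN1r addNr. Qed.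

Lemma linearfun_sum (U V : lmodType F) (f : U -> V) (I : Type) (r : seq I) (c : I -> F) (x : I -> U) :
  linear f -> f (\sum_(i <- r) c i *: x i) = \sum_(i <- r) c i *: f (x i).
Proof.
move=> fl; elim: r => [|i r IH]; last by rewrite !big_cons fl IH.
by rewrite !big_nil linear_at0.
Qed.

Lemma linear_inj_eq0 k (f : 'rV[F]_k -> W) x : linear_inj f -> f x = 0 -> x = 0.
Proof.
by move=> [fl fi] fx; apply: fi; rewrite fx linear_at0.
Qed.

Lemma linear_row k (f : 'rV[F]_k -> W) x : linear f ->
  f x = \sum_i x 0 i *: f (delta_mx 0 i).
Proof. by move=> fl; rewrite {1}[x]row_sum_delta linearfun_sum. Qed.

Lemma quad_formDr (x y z : W) : form z (x + y) = form z x + form z y.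
Proof. by rewrite !(quad_formC z) quad_formDl. Qed.
Lemma quad_form0l (x : W) : form 0 x = 0.
Proof. by have := quad_formBl x x x; rewrite !subrr. Qed.
Lemma quad_formNl (x y : W) : form (- x) y = - form x y.
Proof. by rewrite -[- x]sub0r quad_formBl quad_form0l sub0r. Qed.
Lemma quad_formNr (x y : W) : form x (- y) = - form x y.
Proof. by rewrite !(quad_formC x) quad_formNl. Qed.
Lemma quad_form_suml (I : Type) (r : seq I) (c : I -> F) (x : I -> W) z :
  form (\sum_(i <- r) c i *: x i) z = \sum_(i <- r) c i * form (x i) z.
Proof.
elim: r => [|i r IH]; first by rewrite !big_nil quad_form0l.
by rewrite !big_cons quad_formDl quad_formZl IH.
Qed.

Lemma in_hypZ N a (x : W) : in_hyp N x -> in_hyp N (a *: x).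
Proof. by case/andP=> h1 h2; rewrite /in_hyp /= !(leq_trans (size_scale_leq _ _)). Qed.

Lemma in_hyp0 N : in_hyp N (0 : W).
Proof. by rewrite /in_hyp /= size_poly0. Qed.

Lemma in_hyp_leq N M (x : W) : (N <= M)%N -> in_hyp N x -> in_hyp M x.
Proof. by move=> NM /andP[h1 h2]; rewrite /in_hyp !(leq_trans _ NM). Qed.

Lemma in_hyp_ex (x : W) : exists N, in_hyp N x.
Proof. by exists (maxn (size x.1) (size x.2)); rewrite /in_hyp leq_maxl leq_maxr. Qed.

Lemma linear_in_hyp k (f : 'rV[F]_k -> W) : linear f -> exists N, forall x, in_hyp N (f x).
Proof.
move=> fl; have /choice[n nP] : forall i, exists N, in_hyp N (f (delta_mx 0 i)).
  by move=> i; apply: in_hyp_ex.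
exists (\max_i n i) => x; rewrite linear_row //.
apply: (big_ind (in_hyp (\max_i n i))) => [||i _]; first exact: in_hyp0.
  exact: in_hypD.
by apply: in_hypZ; apply: in_hyp_leq (nP i); apply: leq_bigmax.
Qed.

(** Every vector involves finitely many coordinates, so the hyperbolic planes spanned by e_M and f_M
with M large are orthogonal to any given finite amount of data. They are the supply of vectors with
prescribed norm. *)
Lemma form_far N M a b (x : W) : in_hyp N x -> (N <= M)%N -> form x (hyp_vec a b M) = 0.
Proof.
move=> /andP[h1 h2] NM; rewrite form_hyp_vec !nth_default ?(leq_trans _ NM) //.
by rewrite !mul0r addr0.
Qed.

(** In coordinates f is a matrix with k independent rows, and a right inverse of that matrix produces
vectors with prescribed pairings; the form exchanges e- and f-coordinates, whence the order of [z2]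
and [z1] in the witness. *)
Lemma dual_vector k (f : 'rV[F]_k -> W) (l : 'rV[F]_k) : linear_inj f ->
  exists z, forall x, form (f x) z = (x *m l^T) 0 0.
Proof.
move=> fli; have [fl fi] := fli; have [N fN] := linear_in_hyp fl.
pose M : 'M[F]_(k, N + N) := \matrix_i row_mx (\row_(j < N) (f (delta_mx 0 i)).1`_j)
                                             (\row_(j < N) (f (delta_mx 0 i)).2`_j).
have ME x : x *m M = row_mx (\row_(j < N) (f x).1`_j) (\row_(j < N) (f x).2`_j).
  rewrite (linear_row x fl) mulmx_sum_row; apply/rowP => j.
  rewrite summxE /=; case: (split_ordP j) => i ->; rewrite ?row_mxEl ?row_mxEr mxE.
    pose h (w : W) : F := w.1`_i; rewrite -/(h _).
    rewrite (big_morph h (id1 := 0) (op1 := +%R)); last by rewrite /h /= coef0.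
      by apply: eq_bigr => i' _; rewrite mxE [row _ _ _ _]mxE [M _ _]mxE row_mxEl mxE /h /= coefZ.
    by move=> u v; rewrite /h /= coefD.
  pose h (w : W) : F := w.2`_i; rewrite -/(h _).
  rewrite (big_morph h (id1 := 0) (op1 := +%R)); last by rewrite /h /= coef0.
    by apply: eq_bigr => i' _; rewrite mxE [row _ _ _ _]mxE [M _ _]mxE row_mxEr mxE /h /= coefZ.
  by move=> u v; rewrite /h /= coefD.
have Mf : row_free M.
  apply: inj_row_free => v; rewrite ME => e.
  apply: (linear_inj_eq0 fli); have /andP[s1 s2] := fN v.
  have [e1 e2] := eq_row_mx (etrans e (esym (@row_mx0 _ _ _ _))).
  rewrite [f v]surjective_pairing; congr (_, _); apply/polyP => i; rewrite coef0.
    have [iN|Ni] := ltnP i N; last by rewrite nth_default ?(leq_trans s1).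
    by move/rowP/(_ (Ordinal iN)): e1; rewrite !mxE.
  have [iN|Ni] := ltnP i N; last by rewrite nth_default ?(leq_trans s2).
  by move/rowP/(_ (Ordinal iN)): e2; rewrite !mxE.
have [B MB] := row_freeP Mf; pose z := (B *m l^T)^T.
have [z1 z2] : exists z1 z2 : 'rV_N, z = row_mx z1 z2.
  by exists (lsubmx z), (rsubmx z); rewrite hsubmxK.
case: z2 => z2 zE.
exists (rVpoly z2, rVpoly z1) => x.
rewrite -[LHS]/(hyp_form _ _) (hyp_formE (N := N)) /rVpoly ?size_poly //=.
have -> : x *m l^T = (x *m M) *m z^T by rewrite trmxK mulmxA -(mulmxA x) MB mulmx1.
rewrite ME zE tr_row_mx mul_row_col mxE !mxE -big_split /=.
apply: eq_bigr => i _; rewrite !mxE.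
by rewrite -/(rVpoly z1) -/(rVpoly z2) !coef_rVpoly_ord.
Qed.


Definition extend_by k (f : 'rV[F]_k -> W) (v : W) (y : 'rV[F]_(k + 1)) : W :=
  f (lsubmx y) + rsubmx y 0 0 *: v.

Lemma extend_by_linear k (f : 'rV[F]_k -> W) v : linear f -> linear (extend_by f v).
Proof.
move=> fl a x y; rewrite /extend_by !linearP fl !mxE scalerDr scalerA.
by rewrite addrACA scalerDl.
Qed.

Lemma extend_by_inj k (f : 'rV[F]_k -> W) v : linear_inj f -> (forall x, f x <> v) ->
  linear_inj (extend_by f v).
Proof.
move=> [fl fi] vf; split; first exact: extend_by_linear.
have fZ a x : f (a *: x) = a *: f x by rewrite -[a *: x]addr0 fl linear_at0 ?addr0.
suff K y : extend_by f v y = 0 -> y = 0.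
  move=> x y e; apply/eqP; rewrite -subr_eq0; apply/eqP/K.
  by rewrite addrC -scaleN1r extend_by_linear // e scaleN1r addNr.
rewrite /extend_by => e; have [r0|r0] := eqVneq (rsubmx y 0 0) 0; last first.
  case: (vf (- (rsubmx y 0 0)^-1 *: lsubmx y)); rewrite fZ.
  move/eqP: e; rewrite addr_eq0 => /eqP ->.
  by rewrite scaleNr scalerN opprK scalerA mulVf // scale1r.
rewrite r0 scale0r addr0 in e; rewrite -[y]hsubmxK.
have -> : lsubmx y = 0 by apply: fi; rewrite e linear_at0.
have -> : rsubmx y = 0 by apply/rowP => i; rewrite !ord1 r0 mxE.
by rewrite row_mx0.
Qed.

(** A finite-dimensional subspace U is the orthogonal of its orthogonal: when v is outside U, adjoin v
to a basis of U and prescribe the pairings 0, ..., 0, 1. *)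
Lemma separating_vector k (f : 'rV[F]_k -> W) v : linear_inj f -> (forall x, f x <> v) ->
  exists z, (forall x, form (f x) z = 0) /\ form v z = 1.
Proof.
move=> fli vf; have [z zP] := dual_vector (row_mx 0 1%:M) (extend_by_inj fli vf).
have [fl _] := fli; exists z; split=> [x|].
  have := zP (row_mx x 0); rewrite /extend_by row_mxKl row_mxKr mxE scale0r addr0 => ->.
  by rewrite tr_row_mx mul_row_col trmx0 mulmx0 mul0mx addr0 mxE.
have := zP (row_mx 0 1%:M); rewrite /extend_by row_mxKl row_mxKr mxE scale1r linear_at0 // add0r => ->.
by rewrite tr_row_mx mul_row_col mul0mx trmx1 mulmx1 add0r mxE.
Qed.

Lemma far_index k (f : 'rV[F]_k -> W) (vs : seq W) : linear f ->
  exists M, forall a b, (forall x, form (f x) (hyp_vec a b M) = 0) /\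
     {in vs, forall v, form v (hyp_vec a b M) = 0}.
Proof.
move=> fl; have [N fN] := linear_in_hyp fl.
have [M MP] : exists M, {in vs, forall v, in_hyp M v}.
  elim: vs => [|v vs [M MP]]; first by exists 0%N.
  have [M' M'v] := in_hyp_ex v; exists (maxn M M') => u; rewrite inE => /predU1P[->|/MP].
    by apply: in_hyp_leq M'v; rewrite leq_maxr.
  by apply: in_hyp_leq; rewrite leq_maxl.
exists (maxn N M) => a b; split=> [x|v /MP vM].
  by rewrite (form_far _ _ (fN x)) ?leq_maxl.
by rewrite (form_far _ _ vM) ?leq_maxr.
Qed.

(** Adding e_M + b f_M, with M far away, changes the norm of z by 2b and no pairing with the given
vectors. *)
Lemma orthogonal_vector_norm k (f : 'rV[F]_k -> W) (vs : seq W) (z : W) (c : F) : linear f ->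
  (forall x, form (f x) z = 0) ->
  exists z', [/\ forall x, form (f x) z' = 0, {in vs, forall v, form v z' = form v z}
     & form z' z' = c].
Proof.
move=> fl fz; have [M MP] := far_index (z :: vs) fl.
pose h : W := hyp_vec 1 ((c - form z z) / 2%:R) M; have [hf hv] := MP 1 ((c - form z z) / 2%:R).
have zh : form z h = 0 by rewrite hv ?mem_head.
exists (z + h); split=> [x|v vv|].
- by rewrite quad_formDr fz hf addr0.
- by rewrite quad_formDr hv ?addr0 // inE vv orbT.
rewrite !(quad_formDr, quad_formDl) (quad_formC h z) zh !addr0 add0r.
by rewrite form_hyp_vec2 eqxx !mulr1 mul1r; field.
Qed.

(** The subspace can be recovered from its pointwise stabilizer as the set of fixed vectors. The
isometry is the reflection in a non-isotropic vector that is orthogonal to the subspace, but not to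
v. *)
Lemma move_off_range k (f : 'rV[F]_k -> W) v : linear_inj f -> (forall x, f x <> v) ->
  exists g : G, (forall x, g (f x) = f x) /\ g v <> v.
Proof.
move=> fli vf; have [z [fz vz]] := separating_vector fli vf.
have [z' [fz' vz' z1]] := orthogonal_vector_norm [:: v] 2%:R fli.1 fz.
have n0 : form z' z' != 0 by rewrite z1.
exists (Isometry (refl_subproof n0)); split=> [x|] /=.
  by rewrite /refl_fun fz' mulr0 mul0r scale0r subr0.
rewrite /refl_fun vz' ?mem_head // vz z1 mulr1 divff // scale1r => /eqP.
rewrite -subr_eq0 addrAC subrr add0r oppr_eq0 => /eqP z0.
by move: n0; rewrite z0 quad_form0l eqxx.
Qed.

(** Witt's extension theorem, one vector at a time. The reflection in v - v' is the isometry unless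
v - v' is isotropic. In that case pass through v + z, where z is orthogonal to the range of f and such
that v + z has the norm of v and that neither z nor v + z - v' is isotropic. *)
Lemma witt_step k (f : 'rV[F]_k -> W) v v' : linear_inj f ->
  (forall x, f x <> v) -> (forall x, f x <> v') ->
  (forall x, form (f x) v = form (f x) v') -> form v v = form v' v' ->
  exists g : G, (forall x, g (f x) = f x) /\ g v = v'.
Proof.
move=> fli vf vf' ev eq; have [fl _] := fli.
have [n0|n0] := eqVneq (form (v - v') (v - v')) 0; last first.
  have [g [gv gz]] := refl_swap eq n0; exists g; split=> // x.
  by apply: gz; rewrite quad_formBr ev subrr.
(* The vectors orthogonal to v, or to v', in the orthogonal of the range form two proper subspaces,
   and these do not cover it. *)
have [z0 [fz0 vz0 vz0']] : exists z, [/\ forall x, form (f x) z = 0, form v z != 0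
    & form v' z != 0].
  have [z1 [fz1 vz1]] := separating_vector fli vf.
  have [z2 [fz2 vz2]] := separating_vector fli vf'.
  have [h1|h1] := eqVneq (form v' z1) 0; last by exists z1; rewrite vz1 oner_eq0.
  have [h2|h2] := eqVneq (form v z2) 0; last by exists z2; rewrite vz2 oner_eq0.
  exists (z1 + z2); split=> [x||]; rewrite quad_formDr ?fz1 ?fz2 ?addr0 //.
    by rewrite vz1 h2 addr0 oner_eq0.
  by rewrite vz2 h1 add0r oner_eq0.
(* This norm of z makes v and v + z have the same norm, and v + z - v' have norm -2<v', z>. *)
have [z [fz vz zz]] := orthogonal_vector_norm [:: v; v'] (- (2%:R * form v z0)) fl fz0.
have vzE : form v z = form v z0 by apply: vz; rewrite !inE eqxx.
have vzE' : form v' z = form v' z0 by apply: vz; rewrite !inE eqxx orbT.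
have [g [gv gf]] : exists g : G, g v = v + z /\ forall y, form y (v - (v + z)) = 0 -> g y = y.
  apply: refl_swap.
    by rewrite !(quad_formDl, quad_formDr) (quad_formC z v) zz vzE; ring.
  by rewrite opprD addrA subrr sub0r quad_formNl quad_formNr opprK zz oppr_eq0 mulf_neq0.
have [g' [gv' gf']] : exists g' : G, g' (v + z) = v' /\
    forall y, form y (v + z - v') = 0 -> g' y = y.
  apply: refl_swap.
    by rewrite -eq !(quad_formDl, quad_formDr) (quad_formC z v) zz vzE; ring.
  rewrite addrAC !(quad_formDl (v - v'), quad_formDr (v - v')) n0 zz (quad_formC z).
  rewrite quad_formBl vzE vzE' [X in X != 0](_ : _ = - (2%:R * form v' z0)); last by ring.
  by rewrite oppr_eq0 mulf_neq0.
exists (g' * g)%g; split=> [x|] /=; last by rewrite gv gv'.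
rewrite gf ?gf' //; last by rewrite opprD addrA subrr sub0r quad_formNr fz oppr0.
by rewrite addrAC quad_formDr quad_formBr ev subrr fz addr0.
Qed.

(** An embedding of the quadratic space with Gram matrix A, but phrased for an arbitrary matrix, so that
constructions on matrices need not carry a proof of symmetry. *)
Definition is_frame k (A : 'M[F]_k) (f : 'rV[F]_k -> W) :=
  linear_inj f /\ forall x y, form (f x) (f y) = (x *m A *m y^T) 0 0.

Lemma frame_conj k (A : 'M[F]_k) f f' : is_frame A f -> is_frame A f' ->
  exists g : G, forall x, g (f x) = f' x.
Proof.
elim: k A f f' => [|k IH].
  move=> A f f' [[fl _] _] [[fl' _] _]; exists 1%g => x.
  by rewrite (thinmx0 x) /= !linear_at0.
rewrite -[k.+1]addn1 => A f f' [fli fA] [fli' fA'].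
have [[fl fi] [fl' fi']] := (fli, fli').
pose c (h : 'rV[F]_(k + 1) -> W) (x : 'rV_k) := h (row_mx x 0).
have cl h : linear h -> linear (c h).
  by move=> hl a x y; rewrite /c -hl scale_row_mx add_row_mx scaler0 addr0.
have ci h : injective h -> injective (c h).
  by move=> hi x y /hi/eq_row_mx[].
have cA h : is_frame A h -> is_frame (ulsubmx A) (c h).
  move=> [[hl hi] hA]; split; first by split; [apply: cl|apply: ci].
  move=> x y; rewrite hA -{1}[A]submxK mul_row_block tr_row_mx mul_row_col.
  by rewrite trmx0 mulmx0 !mul0mx !addr0.
have [g gP] := IH _ _ _ (cA f (conj fli fA)) (cA f' (conj fli' fA')).
have [gl gb gf] := isometryP g.
pose e : 'rV[F]_(k + 1) := row_mx 0 1%:M.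
have hE h y : linear h -> h y = c h (lsubmx y) + rsubmx y 0 0 *: h e.
  move=> hl; rewrite addrC -hl /e scale_row_mx add_row_mx scaler0 add0r addr0 scalemx1.
  by rewrite -mx11_scalar hsubmxK.
have out h x : injective h -> c h x <> h e.
  by move=> hi /hi/eq_row_mx[_ /matrixP/(_ 0 0)/eqP]; rewrite !mxE eq_sym oner_eq0.
have [g' [gv1 gv2]] : exists g' : G, (forall x, g' (c f' x) = c f' x) /\ g' (g (f e)) = f' e.
  apply: witt_step.
  - by split; [apply: cl|apply: ci].
  - by move=> x; rewrite -gP => /(bij_inj gb); exact: out.
  - by move=> x; apply: out.
  - by move=> x; rewrite -{1}gP gf fA fA'.
  by rewrite gf fA fA'.
exists (g' * g)%g => y; rewrite (hE f) // (hE f') //=.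
have [gl' _ _] := isometryP g'.
by rewrite addrC gl gl' gv2 gP gv1 addrC.
Qed.

(** The i-th vector is e_i plus half of the i-th row of A along the f_j. *)
Lemma frame_exists k (A : 'M[F]_k) : A^T = A -> exists f, is_frame A f.
Proof.
move=> As; pose f (x : 'rV[F]_k) : W := (rVpoly x, rVpoly (2%:R^-1 *: (x *m A))).
exists f; split; first split.
- by move=> a x y; rewrite /f mulmxDl -scalemxAl scalerDr scalerA mulrC -scalerA !linearP.
- by move=> x y [/(can_inj rVpolyK)].
move=> x y; rewrite -[LHS]/(hyp_form _ _) (hyp_formE (N := k)) /= ?size_poly //.
have yE : (x *m A *m y^T) 0 0 = (y *m A *m x^T) 0 0.
  have -> : y *m A *m x^T = (x *m A *m y^T)^T by rewrite !trmx_mul trmxK As mulmxA.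
  by rewrite [RHS]mxE.
apply: (mulfI F2); rewrite [RHS]mulr_natl [RHS]mulr2n {1}yE.
rewrite [(y *m A *m _) _ _]mxE [(x *m A *m _) _ _]mxE mulr_sumr -big_split.
apply: eq_bigr => i _; rewrite !coef_rVpoly_ord /= [x^T _ _]mxE [y^T _ _]mxE.
rewrite [(_ *: (x *m A)) _ _]mxE [(_ *: (y *m A)) _ _]mxE.
by field.
Qed.

End HypGeometry.

(** * Sets of frames *)
Section TransitiveGSets.
Variable G : groupType.

(** The stabilizers of the points of a transitive set form one conjugacy class of subgroups. *)
Lemma same_stab_iso (S T : gset G) (x : S) (y : T) :
  gtransitive S -> gtransitive T -> stab x = stab y -> gset_iso S T.
Proof.
move=> St Tt xy; apply/(stabs_iso St Tt).
have conj (U : gset G) (z : U) g k : stab (gact g z) k <-> stab z (g^-1 * k * g)%g.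
  rewrite /stab /= !gactM; split=> [->|e]; first by rewrite gactK.
  by rewrite -[LHS](gactKV g) e.
have trans (U V : gset G) (u : U) (v : V) : gtransitive U -> stab u = stab v ->
    (stabs U `<=` stabs V)%classic.
  move=> [_ Ut] uv H [z _ <-]; have /asboolP[g ->] := Ut u z.
  exists (gact g v) => //; rewrite predeqE => k; rewrite !conj uv.
  by [].
by rewrite classical_sets.eqEsubset; split; [exact: trans St xy|exact: trans Tt (esym xy)].
Qed.
End TransitiveGSets.

Section FrameSets.
Variable F : fieldType.
Local Notation W := (hyp_space F).
Local Notation form := (@quad_form F W).
Local Notation G := (isometries W).

Section Frames.
Variables (k : nat) (A : 'M[F]_k).
Record frame := Frame {
  frame_fun :> 'rV[F]_k -> W; frame_subproof : `[< is_frame A frame_fun >] }.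
HB.instance Definition _ := [isSub for frame_fun].
HB.instance Definition _ := [Choice of frame by <:].

Lemma frameP (f : frame) : is_frame A f.
Proof. by case: f => f /= /asboolP. Qed.
Lemma frame_linear (f : frame) : linear f. Proof. by have [[]] := frameP f. Qed.
Lemma frame_inj (f : frame) : injective f. Proof. by have [[]] := frameP f. Qed.
Lemma frame_form (f : frame) x y : form (f x) (f y) = (x *m A *m y^T) 0 0.
Proof. by have [_ ->] := frameP f. Qed.
Lemma frame_eq (f g : frame) : f =1 g -> f = g.
Proof. by move=> e; apply/val_inj/funext. Qed.

Definition mk_frame f (h : is_frame A f) : frame := Frame (asboolT h).

Fact frame_act_subproof (g : G) (f : frame) : is_frame A (g \o f).
Proof.
have [gl gb gf] := isometryP g; have [[fl fi] fA] := frameP f.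
split; last by move=> x y /=; rewrite gf fA.
by split; [move=> a x y /=; rewrite fl gl|apply: inj_comp => //; apply: bij_inj].
Qed.
Definition frame_act g f := mk_frame (frame_act_subproof g f).
Definition frame_gset : gset G.
Proof.
refine (@Gset G frame frame_act _ _).
- by move=> f; apply: frame_eq.
- by move=> g h f; apply: frame_eq.
Defined.

Lemma frame_smooth : smooth (natural_gset W) frame_gset.
Proof.
move=> f; exists [seq f (delta_mx 0 i) | i <- enum 'I_k] => g; split=> [e v|e].
  by move=> /mapP[i _ ->]; rewrite -{2}e.
have [gl _ _] := isometryP g.
apply: frame_eq => x /=; rewrite (linear_row x (@frame_linear f)) linearfun_sum //.
by apply: eq_bigr => i _; congr (_ *: _); apply: e; apply/mapP; exists i; rewrite ?mem_enum.
Qed.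
End Frames.

Lemma frame_stabP k (A : 'M[F]_k) (f : frame_gset A) g : stab f g <-> forall x, g (f x) = f x.
Proof.
split=> [e x|e]; first by rewrite -[in RHS]e.
by apply: frame_eq => x /=; rewrite e.
Qed.

Lemma pull_is_frame k l (A : 'M[F]_k) (B : 'M[F]_l) (P : 'M[F]_(k, l)) (Q : 'M[F]_(l, k)) :
  P *m Q = 1%:M -> A = P *m B *m P^T -> forall f : frame B, is_frame A (f \o mulmxr P).
Proof.
move=> PQ AE f; have [[fl fi] fB] := frameP f; split; first split.
- by move=> a x y /=; rewrite mulmxDl -scalemxAl fl.
- by move=> x y /= /fi /(congr1 (mulmx^~ Q)); rewrite -!mulmxA PQ !mulmx1.
by move=> x y /=; rewrite fB AE trmx_mul !mulmxA.
Qed.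

Lemma frame_gset_congr k l (A : 'M[F]_k) (B : 'M[F]_l) (P : 'M[F]_(k, l)) (Q : 'M[F]_(l, k)) :
  P *m Q = 1%:M -> Q *m P = 1%:M -> A = P *m B *m P^T ->
  gset_iso (frame_gset B) (frame_gset A).
Proof.
move=> PQ QP AE.
have BE : B = Q *m A *m Q^T by rewrite AE !mulmxA QP mul1mx -mulmxA -trmx_mul QP trmx1 mulmx1.
exists (fun f => mk_frame (pull_is_frame PQ AE f)); last by move=> g f; apply: frame_eq.
exists (fun f => mk_frame (pull_is_frame QP BE f)) => f; apply: frame_eq => x /=;
  by rewrite -mulmxA ?PQ ?QP mulmx1.
Qed.

Hypothesis F2 : (2%:R : F) != 0.

Lemma frame_trans k (A : 'M[F]_k) (f : frame A) : gtransitive (frame_gset A).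
Proof.
split; first by exists f.
move=> f1 f2; have [g gP] := frame_conj F2 (frameP f1) (frameP f2).
by apply/asboolP; exists g; apply: frame_eq => x; rewrite -gP.
Qed.

(** A frame and its image have the same stabilizer, hence span the same subspace by [move_off_range];
P and Q are the changes of basis between the two frames. *)
Lemma frame_iso_congr k l (A : 'M[F]_k) (B : 'M[F]_l) : frame A ->
  gset_iso (frame_gset A) (frame_gset B) ->
  exists P, exists Q, [/\ P *m Q = 1%:M, Q *m P = 1%:M & A = P *m B *m P^T].
Proof.
move=> f [h hb hE]; pose f' : frame B := h f.
have st : stab (f' : frame_gset B) = stab (f : frame_gset A).
  by apply: stab_inj => //; apply: bij_inj.
have sub m n (C : 'M[F]_m) (D : 'M[F]_n) (u : frame_gset C) (v : frame_gset D) :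
    stab v = stab u -> exists P, forall x, u x = v (x *m P).
  move=> e; have /choice[p pE] : forall i, exists y, u (delta_mx 0 i) = v y.
    move=> i; have [[y yE]|no] := pselect (exists y, u (delta_mx 0 i) = v y); first by exists y.
    have vli : linear_inj v by split; [apply: frame_linear|apply: frame_inj].
    have [x xE|g [gv []]] := move_off_range F2 vli (v := u (delta_mx 0 i)).
      by apply: no; exists x.
    have : stab v g by apply/frame_stabP.
    by rewrite e => /frame_stabP.
  exists (\matrix_i p i) => x.
  rewrite (linear_row x (@frame_linear _ _ u)) mulmx_sum_row.
  rewrite (linearfun_sum _ _ _ (@frame_linear _ _ v)).
  by apply: eq_bigr => i _; rewrite pE rowK.
have [P PE] := sub _ _ _ _ _ _ st; have [Q QE] := sub _ _ _ _ _ _ (esym st).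
have [fi fi'] := (@frame_inj _ _ f, @frame_inj _ _ f').
have PQ : P *m Q = 1%:M.
  apply/row_matrixP => i; rewrite !rowE mulmx1; apply: fi.
  by rewrite [RHS]PE QE mulmxA.
have QP : Q *m P = 1%:M.
  apply/row_matrixP => i; rewrite !rowE mulmx1; apply: fi'.
  by rewrite [RHS]QE PE mulmxA.
exists P, Q; split=> //; apply/matrixP => i j.
have E (C : 'M[F]_k) : C i j = ((delta_mx 0 i : 'rV_k) *m C *m (delta_mx 0 j : 'rV_k)^T) 0 0.
  by rewrite -rowE trmx_delta -colE !mxE.
rewrite E [RHS]E -(frame_form f) !PE (frame_form f') trmx_mul !mulmxA.
by [].
Qed.

End FrameSets.

Section FrameClasses.
Variables (F : finFieldType) (oddF : odd #|F|).
Local Notation W := (hyp_space F).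
Local Notation form := (@quad_form F W).
Local Notation P := (orthogonal_group oddF).
Local Notation B := (burnside P).
Let F2 : (2%:R : F) != 0 := odd_card_two_neq0 oddF.

Definition frame_sgset k (A : 'M[F]_k) : sgset P :=
  @SGset P (frame_gset A) (@frame_smooth F k A).

Definition frame_class k (A : 'M[F]_k) : B := burnside_class (frame_sgset A).

Lemma finite_orbits_frame k (A : 'M[F]_k) : finite_orbits (frame_sgset A).
Proof.
have [[f _]|no] := pselect (exists f : frame A, True).
  exact: (@transitive_finite P) (frame_trans F2 f).
by exists [::] => f; case: no; exists f.
Qed.

Lemma frame_class_congr k (A : 'M[F]_k) Q : Q \in unitmx ->
  frame_class (Q *m A *m Q^T) = frame_class A.
Proof.
move=> Qu; apply: burnside_class_iso; last exact: finite_orbits_frame.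
by apply: (frame_gset_congr (P := Q) (Q := invmx Q)); rewrite ?mulmxV ?mulVmx.
Qed.

(** The pointwise stabilizer of a finite set is that of a basis of its span. *)
Lemma finite_set_frame (s : seq W) : exists k (f : 'rV[F]_k -> W), linear_inj f /\
  forall g : isometries W, (forall x, g (f x) = f x) <-> {in s, forall v, g v = v}.
Proof.
elim: s => [|v s [k [f [fli fP]]]].
  exists 0%N, (fun=> 0); split; first split.
  - by move=> a x y; rewrite scaler0 addr0.
  - by move=> x y _; rewrite (thinmx0 x) (thinmx0 y).
  by move=> g; split=> // _ x; have [gl _ _] := isometryP g; apply: linear_at0.
have [[x xE]|no] := pselect (exists x, f x = v).
  exists k, f; split=> // g; rewrite fP; split=> [e u|e u us]; last by apply: e; rewrite inE us orbT.
  by rewrite inE => /predU1P[->|/e//]; rewrite -xE; apply: (fP g).2.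
exists (k + 1)%N, (extend_by f v); split.
  by apply: extend_by_inj => // x xE; apply: no; exists x.
have [fl fi] := fli => g; have [gl _ _] := isometryP g; split=> [e u|e x].
  rewrite inE => /predU1P[->|].
    have := e (row_mx 0 1%:M).
    by rewrite /extend_by row_mxKl row_mxKr mxE scale1r linear_at0 // add0r.
  move: u; apply: (fP g).1 => x; have := e (row_mx x 0).
  by rewrite /extend_by row_mxKl row_mxKr mxE scale0r addr0.
have ef : forall y, g (f y) = f y by apply: (fP g).2 => u us; apply: e; rewrite inE us orbT.
by rewrite /extend_by addrC gl ef e ?mem_head.
Qed.

(** A stabilizer in a transitive smooth set is the stabilizer of a frame, and transitive sets with a
common stabilizer are isomorphic. *)
Lemma burnside_basis_frame (c : iso_class P) :
  exists k (A : 'M[F]_k), A^T = A /\ burnside_basis c = frame_class A.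
Proof.
have [[x _] tr] := class_rep_trans c.
have [s sP] := @sgsetP P (class_rep c) x.
have [k [f [fli fP]]] := finite_set_frame s.
pose A : 'M[F]_k := \matrix_(i, j) form (f (delta_mx 0 i)) (f (delta_mx 0 j)).
have fA : is_frame A f.
  have [fl _] := fli; split=> // u v; rewrite (linear_row u fl) quad_form_suml.
  rewrite -mulmxA mxE; apply: eq_bigr => i _; congr (_ * _).
  rewrite quad_formC (linear_row v fl) quad_form_suml mxE; apply: eq_bigr => j _.
  by rewrite !mxE mulrC quad_formC.
exists k, A; split.
  by apply/matrixP => i j; rewrite !mxE quad_formC.
pose f' : frame A := mk_frame fA.
rewrite -burnside_class_rep; apply: burnside_class_iso; last exact: finite_orbits_frame.
apply: (@same_stab_iso _ (frame_gset A) _ f' x).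
- exact: frame_trans.
- exact: class_rep_trans.
rewrite predeqE => g; rewrite frame_stabP /=.
by rewrite (fP g) [X in _ <-> X](sP g).
Qed.

Lemma frame_class0 (A : 'M[F]_0) : frame_class A = 1.
Proof.
have fA : is_frame A (fun=> 0 : W).
  split; first split.
  - by move=> a x y; rewrite scaler0 addr0.
  - by move=> x y _; rewrite (thinmx0 x) (thinmx0 y).
  by move=> x y; rewrite (thinmx0 x) !mul0mx mxE quad_form0l.
apply: burnside_class_iso; last exact: (@transitive_finite P) (gset_unit_trans _).
exists (fun=> mk_frame fA : frame_gset A).
  exists (fun=> tt) => [[]//|f]; apply: frame_eq => x /=.
  by rewrite (thinmx0 x) linear_at0 //; apply: frame_linear.
move=> g []; apply: frame_eq => x /=.
by have [gl _ _] := isometryP g; rewrite linear_at0.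
Qed.
End FrameClasses.

(** * The product with a line *)
Section GramMatrices.
Variable F : fieldType.

(** The Gram matrix of a frame extended by a vector of norm a, where l lists the pairings of that vector
with the frame. *)
Definition gram_add k (A : 'M[F]_k) (l : 'rV[F]_k) (a : F) : 'M[F]_(k + 1) :=
  block_mx A l^T l a%:M.

Definition gram_norm k (A : 'M[F]_k) (u : 'rV[F]_k) : F := (u *m A *m u^T) 0 0.

Lemma gram_addE k (A : 'M[F]_k) l a (x y : 'rV_(k + 1)) :
  (x *m gram_add A l a *m y^T) 0 0 =
  (lsubmx x *m A *m (lsubmx y)^T) 0 0 + rsubmx x 0 0 * (l *m (lsubmx y)^T) 0 0 +
  rsubmx y 0 0 * (l *m (lsubmx x)^T) 0 0 + a * rsubmx x 0 0 * rsubmx y 0 0.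
Proof.
pose s : F := rsubmx x 0 0; pose t : F := rsubmx y 0 0; rewrite -/s -/t.
have xE : x = row_mx (lsubmx x) s%:M by rewrite -mx11_scalar hsubmxK.
have yE : y = row_mx (lsubmx y) t%:M by rewrite -mx11_scalar hsubmxK.
rewrite {1}xE {1}yE /gram_add mul_row_block tr_row_mx mul_row_col tr_scalar_mx.
rewrite mul_mx_scalar !mul_scalar_mx mulmxDl -scalemxAl.
have -> : lsubmx x *m l^T = (l *m (lsubmx x)^T)^T by rewrite trmx_mul trmxK.
rewrite [LHS]mxE [X in X + _]mxE [X in _ + X]mxE [(_ *: (l *m _)) _ _]mxE.
rewrite [(_^T + _) _ _]mxE [(l *m _)^T _ _]mxE.
have -> : (s *: (a%:M : 'M_1)) 0 0 = s * a by rewrite !mxE mulr1n.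
by ring.
Qed.
End GramMatrices.

Section FrameProduct.
Variables (F : finFieldType) (oddF : odd #|F|).
Local Notation W := (hyp_space F).
Local Notation form := (@quad_form F W).
Local Notation P := (orthogonal_group oddF).
Local Notation B := (burnside P).

Lemma vector_is_frame (v : W) a : v != 0 -> form v v = a ->
  is_frame (a%:M : 'M[F]_1) (fun s => s 0 0 *: v).
Proof.
move=> v0 va; split; first split.
- by move=> b x y; rewrite !mxE scalerDl scalerA.
- move=> x y /eqP; rewrite -subr_eq0 -scalerBl scaler_eq0 (negbTE v0) orbF subr_eq0 => /eqP xy.
  by apply/rowP => i; rewrite !ord1.
move=> x y; rewrite quad_formZl quad_formC quad_formZl va mul_mx_scalar -scalemxAl.
by rewrite mxE [(x *m _) _ _]mxE big_ord1 mxE; ring.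
Qed.

Section Pairs.
Variables (k : nat) (A : 'M[F]_k) (a : F).

Lemma frame_left_subproof l (h : frame (gram_add A l a)) :
  is_frame A (fun x => h (row_mx x 0)).
Proof.
have [[hl hi] hA] := frameP h; split; first split.
- by move=> b x y; rewrite -hl scale_row_mx add_row_mx scaler0 addr0.
- by move=> x y /hi/eq_row_mx[].
move=> x y; rewrite hA gram_addE !row_mxKl !row_mxKr [(0 : 'M_1) 0 0]mxE.
by rewrite !mul0r mulr0 !addr0.
Qed.

Lemma frame_right_subproof l (h : frame (gram_add A l a)) :
  is_frame (a%:M : 'M[F]_1) (fun s => h (row_mx 0 s)).
Proof.
have [[hl hi] hA] := frameP h; split; first split.
- by move=> b x y; rewrite -hl scale_row_mx add_row_mx scaler0 addr0.
- by move=> x y /hi/eq_row_mx[].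
move=> x y; rewrite hA gram_addE !row_mxKl !row_mxKr trmx0 !mulmx0.
rewrite [(0 : 'M_1) 0 0]mxE !mulr0 !add0r mul_mx_scalar -scalemxAl.
by rewrite mxE [(x *m _) _ _]mxE big_ord1 mxE mulrA.
Qed.

Lemma frame_multiple_subproof (u : 'rV[F]_k) (f : frame A) : u != 0 -> gram_norm A u = a ->
  is_frame (a%:M : 'M[F]_1) (fun s => s 0 0 *: f u).
Proof.
move=> u0 ua; apply: vector_is_frame; last by rewrite frame_form.
apply: contraNneq u0 => fu0; apply/eqP; apply: (@frame_inj _ _ _ f).
by rewrite fu0 linear_at0 //; apply: frame_linear.
Qed.

Let I := ({u : 'rV[F]_k | (u != 0) && (gram_norm A u == a)} + 'rV[F]_k)%type.
Let T (i : I) : sgset P :=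
  match i with inl _ => frame_sgset oddF A | inr l => frame_sgset oddF (gram_add A l a) end.
Let S : sgset P := sgset_prod (frame_sgset oddF A) (frame_sgset oddF (a%:M : 'M_1)).
Let multiple_pair (u : {u : 'rV[F]_k | (u != 0) && (gram_norm A u == a)}) (f : frame A) : S :=
  (f, mk_frame (frame_multiple_subproof f (proj1 (andP (valP u))) (eqP (proj2 (andP (valP u)))))).
Let split_pair l (h : frame (gram_add A l a)) : S :=
  (mk_frame (frame_left_subproof h), mk_frame (frame_right_subproof h)).
Let pair (i : I) : T i -> S :=
  match i with inl u => @multiple_pair u | inr l => @split_pair l end.

Let splitE l (h : frame (gram_add A l a)) y :
  h y = h (row_mx (lsubmx y) 0) + h (row_mx 0 (rsubmx y)).
Proof.
have hl := @frame_linear _ _ _ h.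
have := hl 1 (row_mx (lsubmx y) 0) (row_mx 0 (rsubmx y)).
by rewrite !scale1r add_row_mx add0r addr0 hsubmxK.
Qed.

Let split_gram l (h : frame (gram_add A l a)) x :
  form (h (row_mx x 0)) (h (row_mx 0 1%:M)) = (l *m x^T) 0 0.
Proof.
rewrite frame_form gram_addE !row_mxKl !row_mxKr trmx0 !mulmx0 [(0 : 'M_1) 0 0]mxE.
by rewrite [1%:M 0 0]mxE !(mulr0, mul0r, addr0, add0r) mul1r.
Qed.

(** In a pair formed by a frame f and a nonzero vector v of norm a, either v = f u for a unique nonzero u of
norm a, or f and v together form a frame, determined up to the group by the pairings of v with f. *)
Lemma frame_class_mul :
  frame_class oddF A * frame_class oddF (a%:M : 'M_1) =
  frame_class oddF A *+ #|[pred u : 'rV[F]_k | (u != 0) && (gram_norm A u == a)]|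
    + \sum_l frame_class oddF (gram_add A l a).
Proof.
rewrite -[LHS](burnside_classM (finite_orbits_frame oddF A) (finite_orbits_frame oddF _)).
rewrite (@burnside_class_decomp P S I (index_enum I) T pair).
- rewrite big_sumType /=; congr (_ + _).
  by rewrite sumr_const card_sig.
- move=> [u|l] _ /=; first by move=> f g /(congr1 fst).
  move=> h h' e; apply: frame_eq => y; rewrite splitE [RHS]splitE; congr (_ + _).
    by have /= := congr1 (fun p : S => (p.1 : frame A) (lsubmx y)) e.
  by have /= := congr1 (fun p : S => (p.2 : frame (a%:M : 'M_1)) (rsubmx y)) e.
- move=> [u|l] _ g f; congr (_, _); apply: frame_eq => x //=.
  have [gl _ _] := isometryP g.
  by rewrite -[_ *: f _]addr0 gl linear_at0 // addr0.
- have e2 (p p' : S) : p = p' ->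
    (p.2 : frame (a%:M : 'M_1)) 1%:M = (p'.2 : frame (a%:M : 'M_1)) 1%:M by move=> ->.
  have e1 (p p' : S) x : p = p' -> (p.1 : frame A) x = (p'.1 : frame A) x by move=> ->.
  move=> [u|l] [u'|l'] _ _ /= f f' e; have := e2 _ _ e; rewrite /= ?mxE ?scale1r.
  + by have /= -> := e1 _ _ (val u) e => /frame_inj/val_inj ->.
  + have /= -> := e1 _ _ (val u) e => /frame_inj/eq_row_mx[_ /matrixP/(_ 0 0)/eqP].
    by rewrite !mxE eq_sym oner_eq0.
  + have /= <- := e1 _ _ (val u') e => /frame_inj/eq_row_mx[_ /matrixP/(_ 0 0)/eqP].
    by rewrite !mxE oner_eq0.
  move=> ef; congr inr; apply/rowP => j.
  have /= ej := e1 _ _ (delta_mx 0 j) e.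
  have := split_gram f (delta_mx 0 j); rewrite ef ej split_gram.
  by rewrite trmx_delta -!colE !mxE => ->.
- move=> [f h].
  have [[u uf]|no] := pselect (exists u, f u = h 1%:M).
    have uP : (u != 0) && (gram_norm A u == a).
      apply/andP; split.
        apply/eqP => u0; move: uf; rewrite u0 linear_at0; last exact: frame_linear.
        move/esym => /(linear_inj_eq0 (frameP h).1)/matrixP/(_ 0 0)/eqP.
        by rewrite !mxE oner_eq0.
      by rewrite /gram_norm -(frame_form f) uf frame_form mul1mx trmx1 mulmx1 mxE.
    exists (inl (Sub u uP)); rewrite ?mem_index_enum //; exists f.
    congr (_, _); apply: frame_eq => s /=; rewrite uf.
    have hl := @frame_linear _ _ _ h.
    by rewrite -[RHS]addr0 -(linear_at0 hl) -hl addr0 scalemx1 -mx11_scalar.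
  have [[fl fi] fA] := frameP f; have [[hl hi] hA] := frameP h.
  pose l : 'rV[F]_k := \row_j form (f (delta_mx 0 j)) (h 1%:M).
  have lE x : form (f x) (h 1%:M) = (l *m x^T) 0 0.
    rewrite (linear_row x fl) quad_form_suml mxE; apply: eq_bigr => j _.
    by rewrite !mxE mulrC.
  have hh : form (h 1%:M) (h 1%:M) = a by rewrite hA mul1mx trmx1 mulmx1 mxE.
  have eA : is_frame (gram_add A l a) (extend_by f (h 1%:M)).
    split; first by apply: extend_by_inj => // x xE; apply: no; exists x.
    move=> x y; rewrite gram_addE /extend_by !(quad_formDl, quad_formDr, quad_formZl, quad_formZr).
    rewrite fA (quad_formC (h _) (f _)) !lE hh.
    by ring.
  exists (inr l); rewrite ?mem_index_enum //; exists (mk_frame eA).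
  congr (_, _); apply: frame_eq => x /=; rewrite /extend_by row_mxKl row_mxKr.
    by rewrite mxE scale0r addr0.
  by rewrite linear_at0 // add0r -[RHS]addr0 -(linear_at0 hl) -hl addr0 scalemx1 -mx11_scalar.
- exact: index_enum_uniq.
by move=> [u|l] _; apply: finite_orbits_frame.
Qed.
End Pairs.

End FrameProduct.

(** * Symmetric matrices up to congruence *)
Section SymmetricMatrices.
Variables (F : fieldType) (F2 : (2%:R : F) != 0).

Lemma gram_norm_congr k (A Q : 'M[F]_k) u : gram_norm (Q *m A *m Q^T) u = gram_norm A (u *m Q).
Proof. by rewrite /gram_norm trmx_mul !mulmxA. Qed.

Lemma gram_add_sym k (A : 'M[F]_k) l a : A^T = A -> (gram_add A l a)^T = gram_add A l a.
Proof. by move=> As; rewrite /gram_add tr_block_mx trmxK As tr_scalar_mx. Qed.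

Lemma gram_normD k (A : 'M[F]_k) u v : A^T = A ->
  gram_norm A (u + v) = gram_norm A u + 2%:R * (u *m A *m v^T) 0 0 + gram_norm A v.
Proof.
move=> As; have sw : (v *m A *m u^T) 0 0 = (u *m A *m v^T) 0 0.
  have -> : v *m A *m u^T = (u *m A *m v^T)^T by rewrite !trmx_mul trmxK As mulmxA.
  by rewrite [LHS]mxE.
rewrite /gram_norm linearD /= !mulmxDl !mulmxDr.
rewrite [LHS]mxE [X in X + _]mxE [X in _ + X]mxE sw.
by ring.
Qed.

(** Polarization. *)
Lemma gram_norm_eq0 k (A : 'M[F]_k) : A^T = A -> (forall u, gram_norm A u = 0) -> A = 0.
Proof.
move=> As A0; apply/matrixP => i j.
have := gram_normD (delta_mx 0 i) (delta_mx 0 j) As; rewrite !A0 addr0 add0r => /esym/eqP.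
by rewrite mulf_eq0 (negbTE F2) /= -rowE trmx_delta -colE !mxE => /eqP.
Qed.

(** The effect of adding to each vector of the frame a multiple, listed by u, of the last vector. *)
Lemma gram_add_clear k (A : 'M[F]_k) l c u : A^T = A ->
  exists2 Q, Q \in unitmx &
    Q *m gram_add A l c *m Q^T = gram_add (A + u^T *m l + l^T *m u + c *: (u^T *m u)) (l + c *: u) c.
Proof.
move=> As; exists (block_mx 1%:M u^T 0 1%:M).
  by rewrite unitmxE (@det_ublock _ k 1) !det1 mulr1 unitr1.
rewrite /gram_add tr_block_mx !mulmx_block !trmx1 trmx0 trmxK.
rewrite !mul1mx !mul0mx !mulmx1 !mulmx0 !add0r !mul_mx_scalar mul_scalar_mx.
congr block_mx.
  by rewrite mulmxDl -scalemxAl !addrA.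
by rewrite linearD linearZ.
Qed.

(** If the last vector has the pairings of a vector u of the span of the frame, subtracting u from it
makes it orthogonal to the frame and changes its norm by the norm of u. *)
Lemma gram_add_range k (A : 'M[F]_k) u a : A^T = A ->
  exists2 Q, Q \in unitmx &
    gram_add A 0 (a - gram_norm A u) = Q *m gram_add A (u *m A) a *m Q^T.
Proof.
move=> As; exists (block_mx 1%:M 0 (- u) 1%:M).
  by rewrite unitmxE (@det_lblock _ k 1) !det1 mulr1 unitr1.
rewrite /gram_add tr_block_mx !mulmx_block !trmx1 !trmx0.
rewrite !mul1mx !mul0mx !mulmx1 !mulmx0 !addr0 trmx_mul As.
rewrite linearN /= !mulNmx !mulmxN !addNr mul0mx oppr0 add0r; congr block_mx.
by rewrite [RHS]addrC raddfB /= /gram_norm mulmxA -mx11_scalar.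
Qed.

(** If some vector has nonzero norm, complete it to a basis and make the other basis vectors orthogonal
to it; otherwise the matrix is zero. *)
Lemma gram_split k (A : 'M[F]_(k + 1)) : A^T = A ->
  exists A' c, A'^T = A' /\ exists2 Q, Q \in unitmx & Q *m A *m Q^T = gram_add A' 0 c.
Proof.
move=> As; have [[v v0]|no] := pselect (exists v, gram_norm A v != 0); last first.
  have A0 : A = 0.
    apply: gram_norm_eq0 => // u; apply/eqP/negPn/negP => u0; apply: no; by exists u.
  exists 0, 0; split; first by rewrite trmx0.
  exists 1%:M; rewrite ?unitmx1 // A0 mulmx0 mul0mx /gram_add trmx0.
  by rewrite raddf0 block_mx0.
pose e : 'rV[F]_(k + 1) := row_mx 0 1%:M.
have ee : e *m e^T = 1%:M by rewrite /e tr_row_mx mul_row_col mul0mx add0r trmx1 mulmx1.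
have vn0 : v != 0 by apply: contraNneq v0 => ->; rewrite /gram_norm !mul0mx mxE.
have en0 : e != 0.
  apply: contraNneq (oner_neq0 F) => e0; move/matrixP/(_ 0 0): ee.
  by rewrite e0 mul0mx !mxE => /esym/eqP.
have [|Q Qu eQ] := @complete_unitmx _ _ _ e (e^T *m v).
  by rewrite mulmxA ee mul1mx !rank_rV vn0 en0.
rewrite mulmxA ee mul1mx in eQ.
pose C : 'M[F]_(k + 1) := Q *m A *m Q^T.
have Cs : C^T = C by rewrite /C !trmx_mul trmxK As mulmxA.
have c0 : gram_norm C e != 0 by rewrite gram_norm_congr -eQ.
have CE : C = gram_add (ulsubmx C) (dlsubmx C) (gram_norm C e).
  rewrite -{1}[C]submxK /gram_add trmx_dlsub Cs; congr block_mx.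
  rewrite /gram_norm -mx11_scalar -{2}[C]submxK /e mul_row_block tr_row_mx mul_row_col.
  by rewrite !mul0mx !add0r !mul1mx trmx0 mulmx0 add0r trmx1 mulmx1.
have us : (ulsubmx C)^T = ulsubmx C by rewrite trmx_ulsub Cs.
set c := gram_norm C e in c0 CE; set l := dlsubmx C in CE.
have [y yE] : exists y, y = - c^-1 *: l by eexists.
have [R Ru RE] := gram_add_clear l c y us.
exists (ulsubmx C + y^T *m l + l^T *m y + c *: (y^T *m y)), c; split.
  by rewrite 3!linearD /= linearZ /= !trmx_mul !trmxK us; congr (_ + _); rewrite addrAC.
exists (R *m Q); first by rewrite unitmx_mul Ru.
have -> : R *m Q *m A *m (R *m Q)^T = R *m C *m R^T by rewrite /C trmx_mul !mulmxA.
by rewrite {1}CE RE [l + _](_ : _ = 0) // yE scalerA mulrN divff // scaleN1r subrr.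
Qed.

Lemma rank_addsmx_row m n (C : 'M[F]_(m, n)) (d : 'rV_n) : ~~ (d <= C)%MS ->
  (\rank C < \rank (col_mx C d))%N.
Proof.
move=> dC; have : (C < C + d)%MS.
  rewrite /ltmx addsmxSl /=; apply: contra dC => h.
  exact: submx_trans (addsmxSr _ _) h.
by rewrite ltmxErank => /andP[_]; rewrite addsmxE.
Qed.

(** The new row raises the rank by one, and, by symmetry, the new column does so once more. *)
Lemma rank_gram_add_out k (A : 'M[F]_k) l a : A^T = A -> ~~ (l <= A)%MS ->
  (\rank A + 2 <= \rank (gram_add A l a))%N.
Proof.
move=> As lA; rewrite addn2.
have h1 := rank_addsmx_row lA.
apply: (leq_ltn_trans h1).
rewrite -mxrank_tr tr_col_mx As /gram_add block_mxEv.
apply: rank_addsmx_row; apply: contra lA => /submxP[D].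
rewrite mul_mx_row => /eq_row_mx[-> _]; exact: submxMl.
Qed.

Lemma rank_gram_add0 k (A : 'M[F]_k) c : (\rank (gram_add A 0 c) <= \rank A + 1)%N.
Proof. by rewrite /gram_add trmx0 rank_diag_block_mx leq_add2l rank_leq_col. Qed.

End SymmetricMatrices.

(** * Generation by the classes of lines *)
Section FiberSums.
Variables (F : finFieldType) (V : zmodType).

Definition fiber_size k n (M : 'M[F]_(k, n)) := #|[pred u : 'rV[F]_k | u *m M == 0]|.

(** The nonempty fibres of a linear map are translates of its kernel. *)
Lemma sum_mulmx k n (M : 'M[F]_(k, n)) (g : 'rV[F]_n -> V) :
  \sum_u g (u *m M) = (\sum_(l | (l <= M)%MS) g l) *+ fiber_size M.
Proof.
rewrite (partition_big (mulmx^~ M) (fun l => (l <= M)%MS)) /=; last by move=> u _; apply: submxMl.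
rewrite -sumrMnl; apply: eq_bigr => l /submxP[u0 ->].
rewrite (reindex_inj (addIr u0)) /= (eq_bigl [pred u | u *m M == 0]) => [|u]; last first.
  by rewrite /= mulmxDl -subr_eq0 addrK.
rewrite (eq_bigr (fun=> g (u0 *m M))) ?sumr_const // => u /eqP uM.
by rewrite mulmxDl uM add0r.
Qed.

Lemma sum_row1 (h : F -> V) : \sum_(l : 'rV[F]_1) h (l 0 0) = \sum_b h b.
Proof.
rewrite (reindex (fun b : F => b%:M : 'rV[F]_1)) /=.
  by apply: eq_bigr => b _; rewrite mxE mulr1n.
exists (fun l : 'rV[F]_1 => l 0 0) => [b _|l _]; first by rewrite mxE mulr1n.
by rewrite -mx11_scalar.
Qed.

Lemma sum_affine (h : F -> V) c d : c != 0 -> \sum_b h (d + c * b) = \sum_b h b.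
Proof.
move=> c0; rewrite [RHS](reindex_inj (h := fun b => d + c * b)) //.
by move=> a b /addrI/(mulfI c0).
Qed.
End FiberSums.

Lemma fiber_size_dvd (F : finFieldType) k n (M : 'M[F]_(k, n)) :
  (fiber_size M %| #|F| ^ k)%N.
Proof.
have := sum_mulmx M (fun=> 1 : int); rewrite !sumr_const card_mx mul1n => /eqP.
by rewrite -mulrnA !natz eqz_nat => /eqP ->; apply: dvdn_mull.
Qed.

Section Generation.
Variables (F : finFieldType) (oddF : odd #|F|).
Local Notation B := (burnside (orthogonal_group oddF)).
Local Notation cl := (frame_class oddF).

(** To be read as: J d b holds if b is a polynomial of degree at most d in the classes of lines, after
inversion of q. The bound on the degree is what the injectivity proof needs. *)
Variable J : nat -> B -> Prop.
Hypothesis J1 : J 0 1.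
Hypothesis JB : forall d a b, J d a -> J d b -> J d (a - b).
Hypothesis JW : forall d b, J d b -> J d.+1 b.
Hypothesis JM : forall d b c, J d b -> J d.+1 (b * cl (c%:M : 'M_1)).
Hypothesis JV : forall d b, J d (b *+ #|F|) -> J d b.

Let J0 d : J d 0.
Proof. by elim: d => [|d /JW//]; rewrite -(subrr 1); apply: JB. Qed.
Let JD d a b : J d a -> J d b -> J d (a + b).
Proof. by move=> ha hb; rewrite -[b]opprK -[- b]sub0r; do 2!apply: (JB) => //. Qed.
Let Jsum d (I : finType) (p : pred I) (g : I -> B) :
  (forall i, p i -> J d (g i)) -> J d (\sum_(i | p i) g i).
Proof. by move=> h; apply: big_ind => //; apply: JD. Qed.
Let JMn d b n : J d b -> J d (b *+ n).
Proof. by move=> h; elim: n => [|n IH]; rewrite ?mulr0n // mulrS; apply: JD. Qed.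
Let JVn d b n m : (n %| #|F| ^ m)%N -> J d (b *+ n) -> J d b.
Proof.
move=> /dvdnP[r nE] /(JMn r); rewrite -mulrnA mulnC -nE.
by elim: m {nE} => [|m IH] //; rewrite expnSr mulrnA => /JV.
Qed.

Section Deconvolution.
Variables (k : nat) (A : 'M[F]_k).
Hypothesis As : A^T = A.
Hypothesis JA : J k (cl A).
Hypothesis Jout : forall l a, ~~ (l <= A)%MS -> J k.+1 (cl (gram_add A l a)).

Let y b := cl (gram_add A 0 b).

Let S a := \sum_u y (a - gram_norm A u).

(** In the product of A with the line of norm a, the bordered matrices with l in the row space of A are,
up to a constant multiplicity, those that occur in S a. *)
Let JS a : J k.+1 (S a).
Proof.
have -> : S a = \sum_u cl (gram_add A (u *m A) a).
  apply: eq_bigr => u _; rewrite /y.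
  by have [Q Qu ->] := gram_add_range u a As; rewrite frame_class_congr.
rewrite (sum_mulmx A (fun l => cl (gram_add A l a))); apply: JMn.
have := frame_class_mul oddF A a; rewrite (bigID (fun l => (l <= A)%MS)) /=.
set out := \sum_(l | ~~ _) _; set ins := \sum_(l | _) _; set n := #|_| => E.
have -> : ins = cl A * cl (a%:M : 'M_1) - cl A *+ n - out.
  by rewrite E [cl A *+ n + _]addrC !addrK.
apply: (JB); last by apply: Jsum => l; apply: Jout.
by apply: (JB); [apply: JM|apply: JMn; apply: JW].
Qed.

Let JT : J k.+1 (\sum_b y b).
Proof.
suff : J k.+1 (\sum_a S a).
  rewrite /S exchange_big /= (eq_bigr (fun=> \sum_b y b)) => [|u _].
    by rewrite sumr_const card_mx mul1n; apply: JVn.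
  by rewrite [RHS](reindex_inj (addIr (- gram_norm A u))).
by apply: Jsum.
Qed.

(** Summing S (c + Q(w)) over w and substituting w - s for u gives the double sum of
y (c - Q(s) + 2 B(w, s)) over s and w, with B the bilinear form of A. For s in the radical of A the sum
over w is a power of q times y c. For all other s, the linear form B(-, s) takes each value equally
often, and the sum over w is a multiple of the sum of all y b. *)
Lemma deconvolution c : J k.+1 (y c).
Proof.
have : J k.+1 (\sum_w S (c + gram_norm A w)) by apply: Jsum.
have -> : \sum_w S (c + gram_norm A w) =
    \sum_s \sum_(w : 'rV[F]_k) y (c - gram_norm A s + 2%:R * (w *m A *m s^T) 0 0).
  rewrite [RHS]exchange_big /=; apply: eq_bigr => w _.
  rewrite {1}/S [LHS](reindex_inj (@subrI 'rV[F]_k w)); apply: eq_bigr => s _; apply: (congr1 y).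
  have := gram_normD (w - s) s As; rewrite subrK => ->.
  have -> : ((w - s) *m A *m s^T) 0 0 = (w *m A *m s^T) 0 0 - gram_norm A s.
    by rewrite !mulmxBl [LHS]mxE [X in _ + X]mxE.
  by ring.
rewrite (bigID (fun s => s *m A == 0)) /=; set nul := \sum_(s | _) _; set reg := \sum_(s | ~~ _) _.
have sAT s (w : 'rV[F]_k) : w *m A *m s^T = w *m (s *m A)^T by rewrite trmx_mul As mulmxA.
have nulE : nul = y c *+ (#|F| ^ k * fiber_size A).
  rewrite /nul (eq_bigr (fun=> y c *+ #|F| ^ k)) => [|s /eqP sA].
    by rewrite sumr_const mulrnA.
  have -> : (#|F| ^ k = #|{: 'rV[F]_k}|)%N by rewrite card_mx mul1n.
  rewrite -sumr_const; apply: eq_bigr => w _.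
  by rewrite /gram_norm !sAT sA trmx0 !mulmx0 mxE subr0 mulr0 addr0.
have regJ : J k.+1 reg.
  apply: Jsum => s sA; pose v := (s *m A)^T.
  pose g (l : 'rV[F]_1) := y (c - gram_norm A s + 2%:R * l 0 0).
  rewrite (eq_bigr (fun w => g (w *m v))) => [|w _]; last by rewrite /g sAT.
  rewrite sum_mulmx; apply: JMn.
  have full l : (l <= v)%MS.
    apply: submx_full; rewrite /row_full eqn_leq rank_leq_col lt0n mxrank_eq0.
    by apply: contra sA => /eqP v0; rewrite -[s *m A]trmxK -/v v0 trmx0.
  rewrite (eq_bigl predT) => [|l]; last by rewrite full.
  rewrite (sum_row1 (fun b => y (c - gram_norm A s + 2%:R * b))).
  by rewrite sum_affine ?odd_card_two_neq0.
move=> h; have {h} : J k.+1 nul by rewrite -[nul](addrK reg); apply: (JB).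
rewrite nulE; apply: (@JVn _ _ _ (k + k)).
by rewrite expnD dvdn_mul // fiber_size_dvd.
Qed.
End Deconvolution.

(** Induction on the size, then on decreasing rank. If A splits as A' + <c> then rank A is at most
rank A' + 1, whereas the bordered matrices that [deconvolution] requires to be known beforehand have
rank at least rank A' + 2. *)
Theorem frame_class_generated k (A : 'M[F]_k) : A^T = A -> J k (cl A).
Proof.
elim: k A => [|k IH]; first by move=> A _; rewrite frame_class0.
suff H n (A : 'M[F]_(k + 1)) : A^T = A -> (k + 1 < n + \rank A)%N -> J k.+1 (cl A).
  have H' (A : 'M[F]_(k + 1)) : A^T = A -> J (k + 1)%N (cl A).
    move=> As; rewrite [in J _]addn1; apply: (H (k + 2)%N) => //.
    by apply: leq_trans (leq_addr _ _); rewrite ltn_add2l.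
  by move: H'; rewrite addn1.
elim: n A => [|n IHn] A As; first by rewrite add0n ltnNge rank_leq_row.
move=> rA; have [A' [c [As' [Q Qu QE]]]] := gram_split (odd_card_two_neq0 oddF) As.
rewrite -(frame_class_congr oddF A Qu) QE; apply: deconvolution => //; first exact: IH.
move=> l a /(rank_gram_add_out a As') r2; apply: IHn; first exact: gram_add_sym.
have : (\rank A <= \rank A' + 1)%N.
  have <- : \rank (Q *m A *m Q^T) = \rank A.
    by rewrite mxrankMfree ?row_free_unit ?unitmx_tr // eqmxMfull ?row_full_unit.
  by rewrite QE rank_gram_add0.
move=> rA'; apply: (leq_trans rA); rewrite addSnnS leq_add2l.
by apply: leq_trans r2; move: (\rank A') (\rank A) rA' => r r'; rewrite !addnS !addn0 ltnS.
Qed.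
End Generation.

(** * Squares and binary forms over a finite field *)
Section SquareClasses.
Variable F : finFieldType.
Hypothesis F2 : (2%:R : F) != 0.

Definition squares : {set F} := [set x ^+ 2 | x in [set: F]].

Lemma squaresP y : reflect (exists x, y = x ^+ 2) (y \in squares).
Proof.
apply: (iffP imsetP) => [[x _ ->]|[x ->]]; first by exists x.
by exists x; rewrite ?inE.
Qed.

(** A nonzero square has at most two roots, and 0 has only one. *)
Lemma card_squares : (#|F| < 2 * #|squares|)%N.
Proof.
have s0 : 0 \in squares by apply/squaresP; exists 0; rewrite expr0n.
have -> : #|F| = (\sum_(y in squares) #|[set x : F | x ^+ 2 == y]|)%N.
  rewrite -sum1_card (partition_big (fun x => x ^+ 2) (mem squares)) /=; last first.
    by move=> x _; apply/squaresP; exists x.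
  apply: eq_bigr => y _; rewrite -sum1_card; apply: eq_bigl => x; by rewrite inE.
rewrite (bigD1 0) //= (_ : #|[set x : F | x ^+ 2 == 0]| = 1%N); last first.
  by rewrite -(cards1 (0 : F)); apply: eq_card => x; rewrite !inE expf_eq0.
rewrite (cardsD1 0 squares) s0 mulnDr; apply: (@leq_ltn_trans (1 + 2 * #|squares :\ 0%R|)%N).
  2: by rewrite ltn_add2r.
rewrite leq_add2l mulnC -sum_nat_const.
rewrite [X in (X <= _)%N](eq_bigl (mem (squares :\ 0))); last by move=> y; rewrite !inE andbC.
apply: leq_sum => y; rewrite !inE => /andP[_ /squaresP[x ->]].
apply: (@leq_trans #|[set x; - x]|); last by rewrite cards2; case: eqP.
by apply: subset_leq_card; apply/fintype.subsetP => z; rewrite !inE eqf_sqr.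
Qed.

(** The values a x^2 and the values c - b y^2 both fill more than half of the field. *)
Lemma binary_form_universal (a b c : F) : a != 0 -> b != 0 ->
  exists x y : F, a * x ^+ 2 + b * y ^+ 2 = c.
Proof.
move=> a0 b0; pose S1 := [set a * s | s in squares]; pose S2 := [set c - b * s | s in squares].
have c1 : #|S1| = #|squares| by rewrite card_imset // => u v /(mulfI a0).
have c2 : #|S2| = #|squares|.
  by rewrite card_imset // => u v /addrI/oppr_inj/(mulfI b0).
have : S1 :&: S2 != set0.
  rewrite -card_gt0 -(ltn_add2l #|S1 :|: S2|) cardsUI addn0 c1 c2 addnn -mul2n.
  by apply: leq_ltn_trans (max_card _) card_squares.
case/set0Pn => z /setIP[/imsetP[_ /squaresP[x ->] ->] /imsetP[_ /squaresP[y ->] e]].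
by exists x, y; rewrite e subrK.
Qed.

(** The squares and the products of p with a nonzero square are disjoint sets, and by [card_squares]
together they have at least as many elements as the field. *)
Lemma square_class (p a : F) : p != 0 -> (forall x, x ^+ 2 != p) -> a != 0 ->
  exists2 s, s != 0 & a = s ^+ 2 \/ a = s ^+ 2 * p.
Proof.
move=> p0 pns a0.
have s0 : 0 \in squares by apply/squaresP; exists 0; rewrite expr0n.
pose S2 := [set p * s | s in squares :\ 0].
have : a \in squares :|: S2.
  suff -> : squares :|: S2 = [set: F] by rewrite inE.
  apply/eqP; rewrite eqEcard subsetT cardsT /= -(leq_add2r #|squares :&: S2|) cardsUI.
  have -> : squares :&: S2 = set0.
    apply/setP => z; rewrite !inE; apply/negP => /andP[/squaresP[x zx] /imsetP[s]].
    rewrite !inE => /andP[sn0 /squaresP[y sy]] zs.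
    have y0 : y != 0 by apply: contraNneq sn0 => y0; rewrite sy y0 expr0n.
    have /eqP[] := pns (x / y).
    by rewrite expr_div_n -zx zs sy mulfK // expf_neq0.
  have c2 : #|S2| = #|squares :\ 0| by rewrite card_imset //; apply: mulfI.
  rewrite cards0 addn0 c2.
  have := card_squares; rewrite (cardsD1 0 squares) s0 add1n mul2n -addnn addSn ltnS.
  by rewrite addnS.
rewrite !inE => /orP[/squaresP[s sE]|/imsetP[_ /setD1P[_ /squaresP[s ->]] sE]].
  by exists s; [apply: contraNneq a0 => s00; rewrite sE s00 expr0n|left].
exists s; last by right; rewrite mulrC.
by apply: contraNneq a0 => s00; rewrite sE s00 expr0n mulr0.
Qed.

Lemma card_square_roots1 : #|[pred t : F | t ^+ 2 == 1]| = 2%N.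
Proof.
rewrite (eq_card (B := [set 1; -1 : F])) => [|t]; last by rewrite !inE sqrf_eq1.
rewrite cards2; suff -> : 1 != -1 :> F by [].
by rewrite -subr_eq0 opprK.
Qed.
End SquareClasses.

(** * The quadratic relation *)

(** Here [line a] stands for the class of <a>, and [plane a t b] for that of the binary form with Gram
matrix (a, t; t, b). Expand the left-hand side by the product formula. In the products with [line 0]
the planes with t <> 0 have discriminant -t^2 and agree for 1 and p. In the squares, [plane p (p t) p]
and [plane 1 t 1] have discriminants with ratio p^2, and so agree unless t^2 = 1. What remains is
[plane p 0 0 - plane 1 0 0], twice with each sign. *)
Section FormalRelation.
Variables (F : finFieldType) (R : comPzRingType) (line : F -> R) (plane : F -> F -> F -> R).
Hypothesis F2 : (2%:R : F) != 0.
Hypothesis lineM : forall a b, line a * line b =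
  line a *+ #|[pred u : F | (u != 0) && (a * u ^+ 2 == b)]| + \sum_t plane a t b.
Hypothesis plane_diag : forall a t b, a != 0 -> plane a t b = plane a 0 (b - t ^+ 2 / a).
Hypothesis plane_scale : forall s a b, s != 0 -> plane a 0 (s ^+ 2 * b) = plane a 0 b.
Hypothesis plane_disc : forall a b, a != 0 -> b != 0 -> plane a 0 b = plane 1 0 (a * b).

Lemma formal_relation p : p != 0 ->
  (2%:R - line 1 - line p + 2%:R * line 0) * (line 1 - line p) = 0.
Proof.
move=> p0.
have c1 : #|[pred u : F | (u != 0) && (1 * u ^+ 2 == 1)]| = 2%N.
  apply: etrans (card_square_roots1 F2); apply: eq_card => u; rewrite !inE mul1r.
  by have [->|//] := eqVneq u 0; rewrite expr0n eq_sym oner_eq0.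
have c2 : #|[pred u : F | (u != 0) && (p * u ^+ 2 == p)]| = 2%N.
  apply: etrans c1; apply: eq_card => u; rewrite !inE mul1r.
  by rewrite -{2}[p]mulr1 (inj_eq (mulfI p0)).
have c0 (a : F) : a != 0 -> #|[pred u : F | (u != 0) && (a * u ^+ 2 == 0)]| = 0%N.
  move=> a0; apply: eq_card0 => u; rewrite !inE mulf_eq0 (negbTE a0) expf_eq0 /=.
  by case: (u == 0).
have xx := lineM 1 1; have yy := lineM p p; rewrite c1 in xx; rewrite c2 in yy.
have xz := lineM 1 0; have yz := lineM p 0.
rewrite c0 ?oner_eq0 // mulr0n add0r in xz; rewrite c0 // mulr0n add0r in yz.
have diag1 t b : plane 1 t b = plane 1 0 (b - t ^+ 2).
  by rewrite plane_diag ?oner_eq0 // divr1.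
have diagp t b : plane p t b = plane p 0 (b - t ^+ 2 / p) by apply: plane_diag.
pose d := plane p 0 0 - plane 1 0 0.
have d1 : \sum_t plane p t p - \sum_t plane 1 t 1 = d *+ 2.
  rewrite [X in X - _](reindex_inj (mulfI p0)) -sumrB /=.
  rewrite (eq_bigr (fun t : F => if t ^+ 2 == 1 then d else 0)) => [|t _].
    by rewrite -big_mkcond sumr_const card_square_roots1.
  rewrite diag1 diagp; have -> : p - (p * t) ^+ 2 / p = p * (1 - t ^+ 2) by field.
  case: eqP => [->|/eqP t1]; first by rewrite subrr mulr0.
  have t10 : 1 - t ^+ 2 != 0 by rewrite subr_eq0 eq_sym.
  rewrite (plane_disc p0) ?mulf_neq0 // mulrA -expr2 (plane_scale _ _ p0).
  by rewrite subrr.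
have d0 : \sum_t plane 1 t 0 - \sum_t plane p t 0 = - d.
  rewrite -sumrB (bigD1 0) //= big1 ?addr0 ?opprB // => t t0.
  rewrite diag1 diagp (@plane_disc p) //; last first.
    by rewrite sub0r oppr_eq0 mulf_neq0 ?invr_eq0 ?expf_neq0.
  by rewrite (_ : p * _ = 0 - t ^+ 2) ?subrr //; field.
have -> : (2%:R - line 1 - line p + 2%:R * line 0) * (line 1 - line p) =
  2%:R * line 1 - 2%:R * line p - line 1 * line 1 + line p * line p +
  2%:R * (line 1 * line 0 - line p * line 0) by ring.
rewrite xx yy xz yz d0.
have -> : \sum_t plane p t p = d *+ 2 + \sum_t plane 1 t 1 by rewrite -d1 subrK.
by ring.
Qed.
End FormalRelation.

Section Relation.
Variables (F : finFieldType) (oddF : odd #|F|).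
Local Notation B := (burnside (orthogonal_group oddF)).
Local Notation cl := (frame_class oddF).
Let F2 : (2%:R : F) != 0 := odd_card_two_neq0 oddF.

Definition line_class (a : F) : B := cl (a%:M : 'M_1).
Definition plane_class (a t b : F) : B := cl (gram_add (a%:M : 'M_1) t%:M b).

Lemma line_class_scale (s a : F) : s != 0 -> line_class (s ^+ 2 * a) = line_class a.
Proof.
move=> s0; have su : (s%:M : 'M[F]_1) \in unitmx by rewrite unitmxE det_scalar1 unitfE.
rewrite /line_class -[RHS](frame_class_congr oddF _ su) tr_scalar_mx -!scalar_mxM.
by congr (frame_class _ _%:M); ring.
Qed.

(** The base change to the vectors x v1 + y v2 and z v1 + w v2. *)
Lemma plane_class_congr (x y z w a t b : F) : x * w - y * z != 0 ->
  plane_class (a * x ^+ 2 + 2%:R * t * x * y + b * y ^+ 2)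
    (a * x * z + t * (x * w + y * z) + b * y * w)
    (a * z ^+ 2 + 2%:R * t * z * w + b * w ^+ 2) = plane_class a t b.
Proof.
move=> d0; pose Q : 'M[F]_(1 + 1) := block_mx x%:M y%:M z%:M w%:M.
have Qu : Q \in unitmx.
  rewrite unitmxE unitfE; apply: contraNneq d0 => dQ.
  have : \det (Q *m block_mx w%:M (- y)%:M (- z)%:M x%:M) = 0 by rewrite det_mulmx dQ mul0r.
  rewrite mulmx_block -!scalar_mxM -!raddfD /=.
  rewrite (_ : x * - y + y * x = 0); last by ring.
  rewrite (_ : z * w + w * - z = 0); last by ring.
  rewrite raddf0 det_ublock !det_scalar1.
  rewrite (_ : (x * w + y * - z) * (z * - y + w * x) = (x * w - y * z) ^+ 2); last by ring.
  by move/eqP; rewrite expf_eq0 => /andP[].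
rewrite /plane_class -[RHS](frame_class_congr oddF _ Qu); congr frame_class.
rewrite /gram_add tr_block_mx !mulmx_block !tr_scalar_mx -!scalar_mxM -!raddfD /=.
rewrite -!scalar_mxM -!raddfD /=.
by congr block_mx; congr scalar_mx; ring.
Qed.

Lemma plane_class_diag (a t b : F) : a != 0 -> plane_class a t b = plane_class a 0 (b - t ^+ 2 / a).
Proof.
move=> a0; rewrite -(plane_class_congr (x := 1) (y := 0) (z := - t / a) (w := 1) a t b).
  by congr plane_class; field.
by rewrite mul0r mulr1 subr0 oner_eq0.
Qed.

Lemma plane_class_scale (s a b : F) : s != 0 -> plane_class a 0 (s ^+ 2 * b) = plane_class a 0 b.
Proof.
move=> s0; rewrite -(plane_class_congr (x := 1) (y := 0) (z := 0) (w := s) a 0 b).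
  by congr plane_class; ring.
by rewrite mul0r mul1r subr0.
Qed.

(** The form represents 1 by [binary_form_universal], and the vector orthogonal to a vector of norm 1
can be taken of norm ab. *)
Lemma plane_class_disc (a b : F) : a != 0 -> b != 0 -> plane_class a 0 b = plane_class 1 0 (a * b).
Proof.
move=> a0 b0; have [x [y xy]] := binary_form_universal 1 a0 b0.
rewrite -(plane_class_congr (x := x) (y := y) (z := - (b * y)) (w := a * x) a 0 b).
  congr plane_class; first by rewrite -[RHS]xy; ring.
    by ring.
  transitivity (a * b * (a * x ^+ 2 + b * y ^+ 2)); first by ring.
  by rewrite xy mulr1.
rewrite (_ : _ - _ = 1) ?oner_eq0 // -[RHS]xy; ring.
Qed.

Lemma line_classM a b : line_class a * line_class b =
  line_class a *+ #|[pred u : F | (u != 0) && (a * u ^+ 2 == b)]| + \sum_t plane_class a t b.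
Proof.
rewrite [LHS]frame_class_mul; congr (_ *+ _ + _).
  rewrite -(card_image (f := fun u : F => u%:M : 'rV[F]_1)); last first.
    by move=> u v /matrixP/(_ 0 0); rewrite !mxE !mulr1n.
  have nE (v : F) : gram_norm (a%:M : 'M_1) v%:M = a * v ^+ 2.
    by rewrite /gram_norm tr_scalar_mx -!scalar_mxM mxE mulr1n; ring.
  apply: eq_card => u; apply/idP/imageP.
    rewrite inE => /andP[u0]; rewrite [u]mx11_scalar nE => ua.
    exists (u 0 0) => //; rewrite inE ua andbT.
    by apply: contraNneq u0 => u00; rewrite [u]mx11_scalar u00 raddf0.
  move=> [v]; rewrite inE => /andP[v0 va] ->; rewrite inE nE va andbT.
  by apply: contraNneq v0 => /matrixP/(_ 0 0); rewrite !mxE mulr1n => ->.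
rewrite -[RHS](sum_row1 (fun t => plane_class a t b)); apply: eq_bigr => l _.
by rewrite /plane_class -mx11_scalar.
Qed.

Variable p : F.
Hypotheses (p0 : p != 0) (pns : forall x, x ^+ 2 != p).

Lemma line_class_cases a : [\/ line_class a = line_class 1, line_class a = line_class p
  | line_class a = line_class 0].
Proof.
have [->|a0] := eqVneq a 0; first by constructor 3.
have [s s0 [->|->]] := square_class p0 pns a0.
  by constructor 1; rewrite -[s ^+ 2]mulr1 line_class_scale.
by constructor 2; rewrite line_class_scale.
Qed.

Lemma quadratic_relation :
  (2%:R - line_class 1 - line_class p + 2%:R * line_class 0) * (line_class 1 - line_class p) = 0.
Proof.
exact: formal_relation F2 line_classM plane_class_diag plane_class_scale plane_class_disc _ p0.
Qed.
End Relation.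

(** * The classes of the standard quadratic spaces *)
Section QuadraticSpaces.
Variable F : fieldType.

Definition quad_gram m (delta : F) n : 'M[F]_(m + n) :=
  diag_mx (row_mx (quadV_diag m delta) 0).

Lemma quad_gram_sym m delta n : (quad_gram m delta n)^T = quad_gram m delta n.
Proof. exact: tr_diag_mx. Qed.

Lemma diag_form_gram k (d : 'rV[F]_k) (x y : diag_space d) :
  quad_form (diag_space d) x y = ((x : 'rV_k) *m diag_mx d *m (y : 'rV_k)^T) 0 0.
Proof.
rewrite -[LHS]/(diag_form d x y) mul_mx_diag mxE; apply: eq_bigr => i _.
by rewrite !mxE; congr (_ * _); rewrite mulrC.
Qed.

Lemma embedding_frame_iso k (d : 'rV[F]_k) :
  gset_iso (embedding_gset (hyp_space F) (diag_space d)) (frame_gset (diag_mx d)).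
Proof.
have to_f (f : embedding (diag_space d) (hyp_space F)) : is_frame (diag_mx d) f.
  have [fl fi ff] := embeddingP f; split; first by split.
  by move=> x y; rewrite ff diag_form_gram.
have to_e (f : frame (diag_mx d)) : is_embedding (U := diag_space d) (W := hyp_space F) f.
  have [[fl fi] fA] := frameP f; split=> //.
  by move=> x y; rewrite fA diag_form_gram.
exists (fun f => mk_frame (to_f f)); last by move=> g f; apply: frame_eq.
by exists (fun f => mk_embedding (to_e f)) => f; [apply: embedding_inj|apply: frame_eq].
Qed.

Lemma det_quadV_diag m (delta : F) : (0 < m)%N ->
  \det (diag_mx (quadV_diag m delta)) = (-1) ^+ m./2 * delta.
Proof.
by move=> m0; rewrite -[in RHS](mod_disc_V delta m0) /mod_disc mulrA -expr2 sqrr_sign mul1r.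
Qed.

Lemma rank_quad_gram m (delta : F) n : delta != 0 -> \rank (quad_gram m delta n) = m.
Proof.
move=> d0; rewrite /quad_gram diag_mx_row rank_diag_block_mx raddf0 mxrank0 addn0.
apply: mxrank_unit; rewrite unitmxE unitfE.
case: m => [|m]; first by rewrite det_mx00 oner_eq0.
by rewrite det_quadV_diag // mulf_neq0 // signr_eq0.
Qed.

(** The rank gives m and then the size gives n. The radical does not contribute to the upper left block
of a congruence, so that block is a congruence of the nondegenerate parts, and the two discriminants
differ by the square of its determinant. *)
Lemma quad_gram_congr m n m' n' (delta delta' : F) P Q : delta != 0 -> delta' != 0 ->
  P *m Q = 1%:M -> Q *m P = 1%:M ->
  quad_gram m delta n = P *m quad_gram m' delta' n' *m P^T ->
  [/\ m = m', n = n' & (0 < m)%N -> exists s, delta = s ^+ 2 * delta'].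
Proof.
move=> d0 d0' PQ QP e.
have e' : quad_gram m' delta' n' = Q *m quad_gram m delta n *m Q^T.
  by rewrite e !mulmxA QP mul1mx -mulmxA -trmx_mul QP trmx1 mulmx1.
have le k l (A : 'M[F]_k) (C : 'M_l) (R : 'M_(k, l)) : A = R *m C *m R^T -> (\rank A <= \rank C)%N.
  by move=> ->; rewrite (leq_trans (mxrankM_maxl _ _)) // mxrankM_maxr.
have mm : m = m'.
  have := le _ _ _ _ _ e; have := le _ _ _ _ _ e'; rewrite !rank_quad_gram // => h1 h2.
  by apply/eqP; rewrite eqn_leq h1 h2.
have nn : n = n'.
  have /eqP : (m + n == m' + n')%N by rewrite eqn_leq (mulmx1_min PQ) (mulmx1_min QP).
  by rewrite mm => /addnI.
subst m' n'; split=> // m0; exists (\det (ulsubmx P)).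
have := congr1 ulsubmx e; rewrite /quad_gram !diag_mx_row block_mxKul raddf0.
rewrite -{1 2}[P]submxK tr_block_mx !mulmx_block block_mxKul !mulmx0 !addr0 !mul0mx addr0.
move/(congr1 determinant); rewrite !det_mulmx det_tr !det_quadV_diag //.
have s0 : (-1) ^+ m./2 != 0 :> F by rewrite signr_eq0.
by move=> dd; apply: (mulfI s0); rewrite dd; ring.
Qed.

End QuadraticSpaces.

Section QuadraticClasses.
Variables (F : finFieldType) (oddF : odd #|F|).
Local Notation P := (orthogonal_group oddF).
Let F2 : (2%:R : F) != 0 := odd_card_two_neq0 oddF.

Lemma xclass_frame m (delta : F) n :
  xclass oddF m delta n = frame_class oddF (quad_gram m delta n).
Proof.
apply: burnside_class_iso; last exact: finite_orbits_frame.
exact: (@gset_iso_sym P) (embedding_frame_iso _).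
Qed.

Lemma quad_gram_trans m (delta : F) n : gtransitive (frame_sgset oddF (quad_gram m delta n)).
Proof.
have [f fA] := frame_exists F2 (quad_gram_sym m delta n).
exact: (@frame_trans F F2 _ _ (mk_frame fA)).
Qed.

Definition quad_class m (delta : F) n : iso_class P := class_of (quad_gram_trans m delta n).

Lemma quad_class_basis m (delta : F) n :
  frame_class oddF (quad_gram m delta n) = burnside_basis (quad_class m delta n).
Proof. exact: burnside_class_trans. Qed.

Lemma quad_class_inj m n m' n' (delta delta' : F) : delta != 0 -> delta' != 0 ->
  quad_class m delta n = quad_class m' delta' n' ->
  [/\ m = m', n = n' & (0 < m)%N -> exists s, delta = s ^+ 2 * delta'].
Proof.
move=> d0 d0' /(@class_ofP P (frame_sgset oddF _) (frame_sgset oddF _)) h.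
have [f fA] := frame_exists F2 (quad_gram_sym m delta n).
have [R [S [RS SR e]]] := frame_iso_congr F2 (mk_frame fA) h.
exact: quad_gram_congr d0 d0' RS SR e.
Qed.

End QuadraticClasses.

(** * Scalars and coordinates in the localized Burnside ring *)
Section ZinvScalars.
Variables (R : comPzRingType) (N : nat).
Local Notation L := (localization (N%:R : R)).

Fact Zinv_fraction (x : Zinv N) : exists kz : nat * int, N%:R ^+ kz.1 * val x = kz.2%:~R.
Proof. by have /asboolP[k /Num.Theory.intrP[z e]] := valP x; exists (k, z). Qed.

(** The structure map of the localization as an algebra over Z[1/N]. It is computed from a chosen
fraction z / N^k, and [Zinv_scalarE] shows that the choice is irrelevant. *)
Definition Zinv_scalar (x : Zinv N) : L :=
  let kz := projT1 (cid (Zinv_fraction x)) in localization_frac _ kz.2%:~R kz.1.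

Lemma Zinv_scalarE (x : Zinv N) k z : N%:R ^+ k * val x = z%:~R ->
  Zinv_scalar x = localization_frac _ z%:~R k.
Proof.
rewrite /Zinv_scalar; case: cid => -[l w] /= e e'.
apply/localization_fracP; exists 0%N; rewrite expr0 mul1r.
have : (w * N%:R ^+ k - z * N%:R ^+ l)%:~R = 0 :> rat.
  by rewrite rmorphB !rmorphM !rmorphXn !rmorph_nat /= -e -e'; ring.
move/eqP; rewrite intr_eq0 => /eqP/(congr1 (fun i : int => i%:~R : R)).
by rewrite rmorphB !rmorphM !rmorphXn !rmorph_nat.
Qed.

Fact Zinv_scalar_zmod_morphism : zmod_morphism Zinv_scalar.
Proof.
move=> x y; have [[k z] /= ex] := Zinv_fraction x; have [[l w] /= ey] := Zinv_fraction y.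
rewrite (Zinv_scalarE ex) (Zinv_scalarE ey).
rewrite (@Zinv_scalarE _ (k + l) (z * N%:R ^+ l - w * N%:R ^+ k)); last first.
  by rewrite !rmorphB !rmorphM !rmorphXn !rmorph_nat /= -ex -ey exprD; ring.
rewrite -[RHS]/(loc_add _ (loc_opp _)) localization_fracN localization_fracD.
by rewrite rmorphB !rmorphM !rmorphXn !rmorph_nat mulNr.
Qed.

Fact Zinv_scalar_monoid_morphism : monoid_morphism Zinv_scalar.
Proof.
split; first by apply: (@Zinv_scalarE 1 0 1); rewrite rmorph1 mul1r.
move=> x y; have [[k z] /= ex] := Zinv_fraction x; have [[l w] /= ey] := Zinv_fraction y.
rewrite (Zinv_scalarE ex) (Zinv_scalarE ey).
rewrite (@Zinv_scalarE _ (k + l) (z * w)); last first.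
  by rewrite !rmorphM /= -ex -ey exprD; ring.
by rewrite -[RHS]/(loc_mul _ _) localization_fracM rmorphM.
Qed.

HB.instance Definition _ := GRing.isZmodMorphism.Build (Zinv N) L Zinv_scalar
  Zinv_scalar_zmod_morphism.
HB.instance Definition _ := GRing.isMonoidMorphism.Build (Zinv N) L Zinv_scalar
  Zinv_scalar_monoid_morphism.

Lemma Zinv_nat_unit n : (0 < N)%N -> (n %| N)%N -> (n%:R : Zinv N) \is a GRing.unit.
Proof.
move=> N0 /dvdnP[m NE]; have n0 : (0 < n)%N by move: N0; rewrite NE muln_gt0 => /andP[].
apply/andP; rewrite rmorph_nat; split.
  by rewrite Num.Theory.pnatr_eq0 -lt0n.
apply/asboolP; exists 1%N; rewrite expr1 NE natrM mulfK ?rpred_nat //.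
by rewrite Num.Theory.pnatr_eq0 -lt0n.
Qed.

Lemma localization_frac_scalar (b : R) m : (0 < N)%N ->
  exists c : Zinv N, localization_frac _ b m = Zinv_scalar c * localization_in _ b.
Proof.
move=> N0; have Nu := Zinv_nat_unit N0 (dvdnn N).
exists (N%:R ^- m); rewrite (@Zinv_scalarE _ m 1); last first.
  have : N%:R ^+ m * N%:R ^- m = 1 :> Zinv N by rewrite divrr // unitrX.
  by move/(congr1 val); rewrite rmorphM rmorphXn rmorph_nat rmorph1.
rewrite -[RHS]/(loc_mul _ (localization_frac _ b 0)) localization_fracM.
by rewrite rmorph1 mul1r addn0.
Qed.

End ZinvScalars.

Section LocalizedCoordinates.
Variables (P : oligoGroup) (N : nat).
Hypothesis N0 : (0 < N)%N.
Local Notation B := (burnside P).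
Local Notation L := (localization (N%:R : B)).

Let Nq k : (N%:R ^+ k : rat) != 0.
Proof. by rewrite expf_neq0 // Num.Theory.pnatr_eq0 -lt0n. Qed.

(** The coordinate along the basis element c, which is rational since denominators N^k occur. *)
Definition coord (c : iso_class P) (x : L) : rat :=
  (coeff c (repr x).1)%:~R / N%:R ^+ (repr x).2.

Let coeff_natX c (b : B) k : coeff c (b * N%:R ^+ k) = coeff c b * N%:R ^+ k.
Proof. by rewrite -!natrX !mulr_natr raddfMn. Qed.

Lemma coord_frac c b m : coord c (localization_frac _ b m) = (coeff c b)%:~R / N%:R ^+ m.
Proof.
rewrite /coord; have := localization_fracE (localization_frac (N%:R : B) b m).
case: (repr _) => a l /= /localization_fracP[k].
rewrite mulrC => /(congr1 (coeff c)).
rewrite coeff_natX raddf0 raddfB /= !coeff_natX.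
move=> /eqP; rewrite mulf_eq0 expf_eq0 Num.Theory.pnatr_eq0 [N == 0]eqn0Ngt N0 andbF orbF subr_eq0 => /eqP.
move/(congr1 (fun i : int => i%:~R : rat)); rewrite !rmorphM !rmorphXn !rmorph_nat => e.
by apply/eqP; rewrite eqr_div // e.
Qed.

Lemma coordD c : {morph coord c : x y / x + y}.
Proof.
move=> x y; rewrite (localization_fracE x) (localization_fracE y).
rewrite [_ + _]localization_fracD !coord_frac raddfD /= !coeff_natX.
by rewrite rmorphD !rmorphM !rmorphXn !rmorph_nat exprD addf_div.
Qed.

Lemma coord_scalar c (z : Zinv N) x : coord c (Zinv_scalar B z * x) = val z * coord c x.
Proof.
rewrite (localization_fracE x); have [[k w] /= e] := Zinv_fraction z.
rewrite (Zinv_scalarE _ e) [_ * _]localization_fracM !coord_frac.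
have -> : coeff c (w%:~R * (repr x).1) = w * coeff c (repr x).1.
  by rewrite mulrzl raddfMz -mulrzl intz.
rewrite rmorphM /= -e exprD.
by rewrite -[_ * val z * _]mulrA -mulf_div divff ?mul1r ?mulrA.
Qed.

Lemma coord_basis c d : coord c (localization_in _ (burnside_basis d)) = (d == c)%:R.
Proof. by rewrite coord_frac expr0 divr1 /burnside_basis coeffU mul1r; case: eqP. Qed.

Lemma localization_one_neq0 : 1 != 0 :> L.
Proof.
apply/eqP => e; have := congr1 (coord (class_of (gset_unit_trans P))) e.
have -> : (1 : L) = localization_in _ (burnside_basis (class_of (gset_unit_trans P))).
  by rewrite -burnside_class_trans.
rewrite coord_basis eqxx -[0 : L]/(localization_frac _ 0 0) coord_frac raddf0 mul0r.
by move/eqP; rewrite oner_eq0.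
Qed.

End LocalizedCoordinates.

(** * A spanning family modulo the relation *)

(** A left inverse of a square matrix is also a right inverse. *)
Lemma left_inverse_kernel (F : fieldType) (K : finType) (C E : K -> K -> F) (c : K -> F) :
  (forall j l, \sum_i C j i * E i l = (j == l)%:R) ->
  (forall l, \sum_i c i * E i l = 0) -> forall i, c i = 0.
Proof.
move=> CE cE i.
pose MC : 'M[F]_#|K| := \matrix_(a, b) C (enum_val a) (enum_val b).
pose ME : 'M[F]_#|K| := \matrix_(a, b) E (enum_val a) (enum_val b).
pose v : 'rV[F]_#|K| := \row_a c (enum_val a).
have sumE (g : K -> F) : \sum_(a < #|K|) g (enum_val a) = \sum_i g i.
  by rewrite [RHS](reindex (fun a : 'I_#|K| => enum_val a)) //; apply/onW_bij/enum_val_bij.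
have MCE : MC *m ME = 1%:M.
  apply/matrixP => a b; rewrite mxE [RHS]mxE -(inj_eq enum_val_inj) -CE -sumE.
  by apply: eq_bigr => d _; rewrite !mxE.
have vME : v *m ME = 0.
  apply/rowP => a; rewrite mxE [RHS]mxE -[RHS](cE (enum_val a)) -sumE.
  by apply: eq_bigr => d _; rewrite !mxE.
have v0 : v = 0 by rewrite -[v]mulmx1 -(mulmx1C MCE) mulmxA vME mul0mx.
by have := congr1 (fun w : 'rV_#|K| => w 0 (enum_rank i)) v0; rewrite !mxE enum_rankK.
Qed.

Section SpanningFamily.
Variable K : comUnitRingType.
Hypothesis two_unit : (2%:R : K) \is a GRing.unit.
Local Notation A := {mpoly K[3]}.
Local Notation X := ('X_0 : A).
Local Notation Y := ('X_1 : A).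
Local Notation Z := ('X_2 : A).

(** As 2 is invertible, these three polynomials are new variables, up to an affine change. In them the
relation becomes the product of [poly_plane] and [poly_diff]. *)
Definition poly_diff : A := X - Y.
Definition poly_sum : A := X + Y.
Definition poly_plane : A := 1 - 2^-1 *: X - 2^-1 *: Y + Z.
Local Notation D := poly_diff.
Local Notation S := poly_sum.
Local Notation H := poly_plane.

(** The monomials in the new variables that are not divisible by the relation. If m = 0 the two values
of b give the same monomial, and b is then required to be [false]: in this way (m, n, b) also indexes
the quadratic spaces V_{m,1,n} and V_{m,pi,n}, which coincide for m = 0. *)
Definition span_elt m n (b : bool) : A := (if b then H else D) ^+ m * S ^+ n.

(** An inductive predicate instead of explicit coefficients, which makes the closure properties plain
inductions; [spanned_coef] recovers the coefficients. *)
Inductive spanned (d : nat) : A -> Prop :=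
| spanned_ideal a : spanned d (a * (H * D))
| spanned_add c m n (b : bool) p : (m + n <= d)%N -> (b -> 0 < m)%N -> spanned d p ->
    spanned d (c *: span_elt m n b + p).

Lemma spannedD d p q : spanned d p -> spanned d q -> spanned d (p + q).
Proof.
elim=> [a|c m n b {}p h1 h2 _ IH] hq; last first.
  by rewrite -addrA; apply: spanned_add => //; apply: IH.
elim: hq => [a'|c m n b {}q h1 h2 _ IH]; first by rewrite -mulrDl; apply: spanned_ideal.
by rewrite addrCA; apply: spanned_add.
Qed.

Lemma spannedZ d c p : spanned d p -> spanned d (c *: p).
Proof.
elim=> [a|c' m n b {}p h1 h2 _ IH]; first by rewrite scalerAl; apply: spanned_ideal.
by rewrite scalerDr scalerA; apply: spanned_add.
Qed.

Lemma spannedB d p q : spanned d p -> spanned d q -> spanned d (p - q).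
Proof. by move=> hp hq; rewrite -scaleN1r; apply: spannedD => //; apply: spannedZ. Qed.

Lemma spanned_elt d m n (b : bool) : (m + n <= d)%N -> (b -> 0 < m)%N -> spanned d (span_elt m n b).
Proof.
move=> h1 h2; rewrite -[span_elt m n b]scale1r -[1 *: _]addr0; apply: spanned_add => //.
by have := spanned_ideal d 0; rewrite mul0r.
Qed.

Lemma spanned_leq d d' p : (d <= d')%N -> spanned d p -> spanned d' p.
Proof.
move=> dd; elim=> [a|c m n b {}p h1 h2 _ IH]; first exact: spanned_ideal.
by apply: spanned_add => //; apply: leq_trans dd.
Qed.

Lemma spanned1 d : spanned d 1.
Proof.
have -> : 1 = span_elt 0 0 false by rewrite /span_elt !expr0 mulr1.
exact: spanned_elt.
Qed.

Lemma spanned_mul d q : (forall m n (b : bool), (m + n <= d)%N -> (b -> 0 < m)%N ->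
    spanned d.+1 (q * span_elt m n b)) ->
  forall p, spanned d p -> spanned d.+1 (q * p).
Proof.
move=> hq p; elim=> [a|c m n b {}p h1 h2 _ IH]; first by rewrite mulrA; apply: spanned_ideal.
by rewrite mulrDr -scalerAr; apply: spannedD => //; apply: spannedZ; apply: hq.
Qed.

Lemma spanned_mul_sum d p : spanned d p -> spanned d.+1 (S * p).
Proof.
apply: spanned_mul => m n b h1 h2; rewrite /span_elt mulrCA -exprS.
by apply: (spanned_elt (m := m) (n := n.+1)); rewrite ?addnS.
Qed.

Lemma spanned_mul_diff d p : spanned d p -> spanned d.+1 (D * p).
Proof.
apply: spanned_mul => m n [] h1 h2; rewrite /span_elt mulrA.
  case: m h1 h2 => [_ /(_ isT)//|m _ _]; rewrite exprS.
  rewrite (_ : _ * _ * _ = H ^+ m * S ^+ n * (H * D)); first exact: spanned_ideal.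
  by ring.
by rewrite -exprS; apply: (spanned_elt (m := m.+1) (n := n) (b := false)).
Qed.

Lemma spanned_mul_plane d p : spanned d p -> spanned d.+1 (H * p).
Proof.
apply: spanned_mul => m n [] h1 h2; rewrite /span_elt mulrA.
  by rewrite -exprS; apply: (spanned_elt (m := m.+1) (n := n) (b := true)).
case: m h1 {h2} => [|m] h1.
  by rewrite expr0 mulr1; apply: (spanned_elt (m := 1) (n := n) (b := true)).
rewrite exprS (_ : _ * _ * _ = D ^+ m * S ^+ n * (H * D)); first exact: spanned_ideal.
by ring.
Qed.

Lemma spanned_mul_var d p i : spanned d p -> spanned d.+1 ('X_i * p).
Proof.
have half (r : A) : 2^-1 *: (r + r) = r.
  by rewrite -mulr2n -scaler_nat scalerA mulVr // scale1r.
move=> hp; have hS := spanned_mul_sum hp; have hD := spanned_mul_diff hp.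
have [->|->|->] : [\/ i = 0, i = 1 | i = 2%:R].
  case: i => -[|[|[|//]]] h; [constructor 1|constructor 2|constructor 3]; exact: val_inj.
- have -> : X * p = 2^-1 *: (S * p + D * p).
    have SD : S + D = X + X by rewrite /S /D; ring.
    by rewrite -mulrDl SD mulrDl half.
  by apply: spannedZ; apply: spannedD.
- have -> : Y * p = 2^-1 *: (S * p - D * p).
    have SD : S - D = Y + Y by rewrite /S /D; ring.
    by rewrite -mulrBl SD mulrDl half.
  by apply: spannedZ; apply: spannedB.
have -> : Z * p = H * p - p + 2^-1 *: (S * p).
  have E : Z = H - 1 + 2^-1 *: S.
    by rewrite /H /S scalerDr; ring.
  by rewrite {1}E mulrDl mulrBl mul1r scalerAl.
apply: spannedD; last exact: spannedZ.
by apply: spannedB; [apply: spanned_mul_plane|apply: spanned_leq hp].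
Qed.

(** Multiplication by a monomial raises the degree of the combination by a fixed amount. *)
Lemma poly_spanned (p : A) : exists d, spanned d p.
Proof.
pose stable (q : A) := exists d, forall p d', spanned d' p -> spanned (d + d') (q * p).
have stableM q r : stable q -> stable r -> stable (q * r).
  move=> [d hq] [e hr]; exists (d + e)%N => s d' hs; rewrite -mulrA -addnA.
  by apply: hq; apply: hr.
have stable1 : stable 1 by exists 0%N => r d' hr; rewrite mul1r add0n.
have mon (m : 'X_{1..3}) : stable 'X_[m].
  rewrite mpolyXE_id; apply: (big_ind stable) => // i _.
  elim: (m i) => [|k IH]; first by rewrite expr0.
  by rewrite exprS; apply: stableM => //; exists 1%N => r d' hr; apply: spanned_mul_var.
rewrite [p]mpolyE; apply: (big_ind (fun q => exists d, spanned d q)).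
- by exists 0%N; rewrite -(mul0r (H * D)); apply: spanned_ideal.
- move=> q r [d hq] [e hr]; exists (maxn d e); apply: spannedD.
    exact: spanned_leq (leq_maxl _ _) hq.
  exact: spanned_leq (leq_maxr _ _) hr.
move=> m _; have [d hd] := mon m; exists (d + 0)%N; apply: spannedZ.
by rewrite -['X_[m]]mulr1; apply: hd; apply: spanned1.
Qed.

End SpanningFamily.

(** * The presentation *)
Lemma quot_by_lift (R : comPzRingType) (S : pzRingType) (r : R) (f : {rmorphism R -> S}) :
  f r = 0 -> exists phi : {rmorphism quot_by r -> S}, forall x, phi (quot_by_pi r x) = f x.
Proof.
move=> fr0; pose g (x : quot_by r) := f (repr x).
have gE x : g (quot_by_pi r x) = f x.
  have : repr (quot_by_pi r x) - x \in principal_ideal r by rewrite -quot_by_piP quot_by_piK.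
  case/principal_idealP => a e; apply/eqP; rewrite -subr_eq0 -rmorphB e.
  by rewrite rmorphM fr0 mulr0.
have gB : zmod_morphism g.
  move=> x y; rewrite -(quot_by_piK x) -(quot_by_piK y).
  by rewrite -[_ - _]rmorphB !gE rmorphB.
have gM : monoid_morphism g.
  split; first by rewrite -[1](rmorph1 (@quot_by_pi R r)) gE rmorph1.
  move=> x y; rewrite -(quot_by_piK x) -(quot_by_piK y).
  by rewrite -[_ * _]rmorphM !gE rmorphM.
pose phi : {rmorphism quot_by r -> S} := HB.pack g
  (GRing.isZmodMorphism.Build _ _ g gB) (GRing.isMonoidMorphism.Build _ _ g gM).
by exists phi.
Qed.

(** The hypothesis makes L a nonzero ring, the kind of target that the evaluation morphism takes. *)
Lemma mpoly_eval_exists n (K : comNzRingType) (L : comPzRingType) (iota : {rmorphism K -> L})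
    (h : 'I_n -> L) : (1 : L) != 0 ->
  exists f : {rmorphism {mpoly K[n]} -> L},
    (forall i, f 'X_i = h i) /\ forall c p, f (c *: p) = iota c * f p.
Proof.
move=> L10; pose L' : comNzRingType := HB.pack (L : Type) (GRing.ComPzRing.on L)
  (GRing.PzSemiRing_isNonZero.Build L L10).
pose f : {rmorphism {mpoly K[n]} -> L'} := mmap (iota : {rmorphism K -> L'}) (h : 'I_n -> L').
exists f; split=> [i|c p]; first by rewrite /f /= mmapX mmap1U.
by rewrite /f /= mmapZ.
Qed.

Lemma eval_plane_diff (K : comUnitRingType) (B L : comPzRingType) (iota : K -> L)
    (g : {rmorphism B -> L}) (f : {rmorphism {mpoly K[3]} -> L}) (x y z : B) :
  (2%:R : K) \is a GRing.unit -> (forall c q, f (c *: q) = iota c * f q) ->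
  f 'X_0 = g x -> f 'X_1 = g y -> f 'X_2 = g z ->
  (2%:R - x - y + 2%:R * z) * (x - y) = 0 -> f (poly_plane K * poly_diff K) = 0.
Proof.
move=> two_unit fZ fx fy fz xyz.
have half (r : {mpoly K[3]}) : 2^-1 *: (2%:R * r) = r.
  by rewrite mulr_natl -scaler_nat scalerA mulVr // scale1r.
have -> : poly_plane K * poly_diff K =
    2^-1 *: ((2%:R - 'X_0 - 'X_1 + 2%:R * 'X_2) * ('X_0 - 'X_1)).
  by rewrite scalerAl -{1}[2%:R : {mpoly K[3]}]mulr1 !(scalerDr, scalerN) !half.
have mapE (U : comPzRingType) (h : {rmorphism U -> L}) a b c :
    h ((2%:R - a - b + 2%:R * c) * (a - b)) =
    (2%:R - h a - h b + 2%:R * h c) * (h a - h b).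
  by rewrite rmorphM rmorphB rmorphD 2!rmorphB rmorphM rmorph_nat.
rewrite fZ mapE fx fy fz -mapE xyz rmorph0.
exact: mulr0.
Qed.

Lemma scalar_nat_invK (K : unitRingType) (L : pzRingType) (iota : {rmorphism K -> L}) n (y : L) :
  (n%:R : K) \is a GRing.unit -> iota n%:R^-1 * (y *+ n) = y.
Proof.
by move=> nu; rewrite -[y *+ n]mulr_natl mulrA -(rmorph_nat iota) -rmorphM mulVr // rmorph1 mul1r.
Qed.

Section SpannedCoefficients.
Variable K : comUnitRingType.

Definition span_index d :=
  {t : 'I_d.+1 * 'I_d.+1 * bool | (t.1.1 + t.1.2 <= d)%N && (t.2 ==> (0 < t.1.1)%N)}.

Definition span_family d (i : span_index d) : {mpoly K[3]} :=
  span_elt K (val i).1.1 (val i).1.2 (val i).2.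

Lemma spanned_coef d (q : {mpoly K[3]}) : spanned d q ->
  exists (c : span_index d -> K) a,
    q = \sum_i c i *: span_family i + a * (poly_plane K * poly_diff K).
Proof.
elim=> [a|c m n b {}q h1 h2 _ [c' [a qE]]].
  by exists (fun=> 0), a; rewrite big1 ?add0r // => i _; rewrite scale0r.
have hm : (m < d.+1)%N by rewrite ltnS (leq_trans _ h1) // leq_addr.
have hn : (n < d.+1)%N by rewrite ltnS (leq_trans _ h1) // leq_addl.
pose t0 := (Ordinal hm, Ordinal hn, b).
have ht : (t0.1.1 + t0.1.2 <= d)%N && (t0.2 ==> (0 < t0.1.1)%N).
  by rewrite h1; apply/implyP.
pose t : span_index d := Sub t0 ht.
exists (fun i => (if i == t then c else 0) + c' i), a; rewrite qE addrA; congr (_ + _).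
under [RHS]eq_bigr => i _ do rewrite scalerDl.
rewrite big_split /=; congr (_ + _).
rewrite (bigD1 t) //= eqxx big1 ?addr0 // => i /negbTE ->.
by rewrite scale0r.
Qed.
End SpannedCoefficients.

Section Presentation.
Variables (F : finFieldType) (oddF : odd #|F|) (p : F).
Hypotheses (p0 : p != 0) (pns : forall a : F, a ^+ 2 != p).
Local Notation N := (2 * #|F|)%N.
Local Notation B := (burnside (orthogonal_group oddF)).
Local Notation K := (Zinv N).
Local Notation A := {mpoly K[3]}.
Local Notation L := (localization (N%:R : B)).
Local Notation cl := (frame_class oddF).

Let N0 : (0 < N)%N. Proof. by rewrite muln_gt0 /= (odd_gt0 oddF). Qed.

Definition generator (i : 'I_3) : B := nth 0 [:: line_class oddF 1; line_class oddF p; line_class oddF 0] i.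

Variable f : {rmorphism A -> L}.
Hypothesis fX : forall i, f 'X_i = localization_in _ (generator i).
Hypothesis fZ : forall c q, f (c *: q) = Zinv_scalar B c * f q.

Let two_unit : (2%:R : K) \is a GRing.unit.
Proof. by apply: Zinv_nat_unit N0 _; apply: dvdn_mulr. Qed.

Lemma eval_relation : f (poly_plane K * poly_diff K) = 0.
Proof.
exact: eval_plane_diff two_unit fZ (fX 0) (fX 1) (fX 2%:R) (quadratic_relation oddF p0).
Qed.

Definition reached d (b : B) := exists2 q : A, spanned d q & f q = localization_in _ b.

Lemma frame_class_reached k (G : 'M[F]_k) : G^T = G -> reached k (cl G).
Proof.
apply: frame_class_generated.
- by exists 1; [apply: spanned1|rewrite !rmorph1].
- move=> d a b [q hq qa] [r hr rb]; exists (q - r); first exact: spannedB.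
  by rewrite !rmorphB qa rb.
- by move=> d b [q hq qb]; exists q => //; apply: spanned_leq hq.
- move=> d b c [q hq qb].
  have [i iE] : exists i, cl (c%:M : 'M_1) = generator i.
    have [e|e|e] := line_class_cases oddF p0 pns c.
    + by exists 0.
    + by exists 1.
    + by exists 2%:R.
  exists ('X_i * q); first exact: spanned_mul_var.
  by rewrite rmorphM fX qb -iE mulrC rmorphM.
move=> d b [q hq qb]; exists ((#|F|%:R)^-1 *: q); first exact: spannedZ.
have qu : (#|F|%:R : K) \is a GRing.unit by apply: Zinv_nat_unit N0 _; apply: dvdn_mull.
rewrite fZ qb raddfMn.
exact: (scalar_nat_invK (@Zinv_scalar B N : {rmorphism K -> L})).
Qed.

Lemma eval_surjective (y : L) : exists q, f q = y.
Proof.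
rewrite (localization_fracE y); have [c ->] := localization_frac_scalar (repr y).1 (repr y).2 N0.
suff [q qE] : exists q, f q = localization_in _ (repr y).1 by exists (c *: q); rewrite fZ qE.
elim/burnside_ind: (repr y).1 => [d|a b [q qa] [r rb]]; last by exists (q - r); rewrite !rmorphB qa rb.
have [k [G [Gs ->]]] := burnside_basis_frame d.
by have [q _ qE] := frame_class_reached Gs; exists q.
Qed.

Definition span_class d (i : span_index d) : iso_class (orthogonal_group oddF) :=
  quad_class oddF (val i).1.1 (if (val i).2 then p else 1) (val i).1.2.

Lemma span_class_inj d : injective (@span_class d).
Proof.
move=> [[[m n] b] /= hi] [[[m' n'] b'] /= hj] e; apply: val_inj => /=.
have nz (c : bool) : (if c then p else 1) != 0 by case: c; rewrite ?oner_eq0.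
have [/val_inj mm /val_inj nn dd] := quad_class_inj (nz b) (nz b') e.
rewrite /= in mm nn dd; clear e; subst m' n'; congr (_, _, _).
have {hi}/andP[_ hi] := hi; have {hj}/andP[_ hj] := hj.
have ns s : 1 != s ^+ 2 * p.
  apply/negP => /eqP e1; have s0 : s != 0.
    by apply/negP => /eqP s0; move/eqP: e1; rewrite s0 expr0n mul0r oner_eq0.
  have /eqP[] := pns s^-1; apply: (mulfI (expf_neq0 2 s0)).
  by rewrite -e1 exprVn divff // expf_neq0.
case: b b' hi hj dd => [] [] //= hi hj dd; exfalso.
  by have [//|s] := dd; rewrite mulr1 => /esym/eqP; apply/negP.
by have [//|s] := dd; move/eqP; apply/negP.
Qed.

(** For each index j of degree at most d, the class of the corresponding quadratic space is the image of
a combination of span elements, also of degree at most d, with coefficients C j. Therefore C is a left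
inverse of the square matrix of the coordinates of the images of the span elements. That matrix is then
invertible, and only the zero combination of span elements is mapped to 0. *)
Lemma eval_kernel q : f q = 0 -> exists a, q = a * (poly_plane K * poly_diff K).
Proof.
move=> fq; have [d qd] := poly_spanned two_unit q.
have [c [a qE]] := spanned_coef qd.
have co0 (l : span_index d) : coord (span_class l) (0 : L) = 0.
  by apply: (addrI (coord (span_class l) (0 : L))); rewrite -(coordD N0) !addr0.
have co (l : span_index d) (c' : span_index d -> K) a' :
    coord (span_class l) (f (\sum_i c' i *: span_family K i + a' * (poly_plane K * poly_diff K)))
    = \sum_i val (c' i) * coord (span_class l) (f (span_family K i)).
  rewrite rmorphD rmorphM eval_relation mulr0 addr0 rmorph_sum /=.
  rewrite (big_morph _ (coordD N0 (span_class l)) (co0 l)).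
  by apply: eq_bigr => i _; rewrite fZ (coord_scalar N0).
have ex (j : span_index d) : exists c' : span_index d -> K, exists a',
    f (\sum_i c' i *: span_family K i + a' * (poly_plane K * poly_diff K)) =
    localization_in _ (burnside_basis (span_class j)).
  have [r rs rE] := frame_class_reached (quad_gram_sym (val j).1.1 (if (val j).2 then p else 1) (val j).1.2).
  have jd : ((val j).1.1 + (val j).1.2 <= d)%N by case: (j) => t /= /andP[].
  have [c' [a' rc]] := spanned_coef (spanned_leq jd rs).
  by exists c', a'; rewrite -rc rE quad_class_basis.
have /choice[C /choice[a' CE]] := ex.
have c0 : forall i, val (c i) = 0.
  apply: (@left_inverse_kernel _ _ (fun j i => val (C j i))
      (fun i l => coord (span_class l) (f (span_family K i)))) => [j l|l].
    rewrite -(co l (C j) (a' j)) CE (coord_basis N0).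
    by rewrite (inj_eq (@span_class_inj d)).
  by rewrite -(co l c a) -qE fq co0.
exists a; rewrite {1}qE big1 ?add0r // => i _.
by rewrite (_ : c i = 0) ?scale0r //; apply: val_inj; rewrite c0 rmorph0.
Qed.

End Presentation.

Lemma quad_gram_line (F : fieldType) (a : F) : quad_gram 1 a 0 = a%:M :> 'M_1.
Proof.
apply/matrixP => i j; rewrite !ord1 !mxE /= !mulr1n.
by case: splitP => [l _|[]//]; rewrite mxE ord1 /= expr0 mul1r.
Qed.

Lemma quad_gram_null (F : fieldType) (a : F) : quad_gram 0 a 1 = 0%:M :> 'M_1.
Proof.
apply/matrixP => i j; rewrite !ord1 !mxE /= !mulr1n.
by case: splitP => [[]//|l _]; rewrite mxE.
Qed.

Theorem proposition9p6 (F : finFieldType) (oddF : odd #|F|)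
    (pi : F) (pi_neq0 : pi != 0) (pi_nonsquare : forall a : F, a ^+ 2 != pi) :
  let N := (2 * #|F|)%N in
  let B := burnside (orthogonal_group oddF) in
  let X : {mpoly (Zinv N)[3]} := 'X_0 in
  let Y : {mpoly (Zinv N)[3]} := 'X_1 in
  let Z : {mpoly (Zinv N)[3]} := 'X_2 in
  let R := (1 - 2^-1 *: X - 2^-1 *: Y + Z) * (X - Y) in
  exists phi : {rmorphism quot_by R -> localization (N%:R : B)},
    [/\ bijective phi,
        phi (quot_by_pi R X) = localization_in N%:R (xclass oddF 1 1 0),
        phi (quot_by_pi R Y) = localization_in N%:R (xclass oddF 1 pi 0)
      & phi (quot_by_pi R Z) = localization_in N%:R (xclass oddF 0 0 1)].
Proof.
move=> N B X Y Z R.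
have N0 : (0 < N)%N by rewrite muln_gt0 /= (odd_gt0 oddF).
have [f [fX fZ]] := mpoly_eval_exists (@Zinv_scalar B N)
  (fun i : 'I_3 => localization_in (N%:R : B) (generator oddF pi i)) (localization_one_neq0 _ N0).
have [phi phiE] := quot_by_lift (eval_relation pi_neq0 fX fZ).
exists phi; split; last 3 first.
- by rewrite phiE fX xclass_frame quad_gram_line.
- by rewrite phiE fX xclass_frame quad_gram_line.
- by rewrite phiE fX xclass_frame quad_gram_null.
have /choice[h hE] := eval_surjective pi_neq0 pi_nonsquare fX fZ.
have inj : injective phi.
  move=> x y e; apply/eqP; rewrite -subr_eq0 -(quot_by_piK (x - y)).
  have [a aE] : exists a, repr (x - y) = a * R.
    apply: (eval_kernel pi_neq0 pi_nonsquare fX fZ).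
    by rewrite -phiE quot_by_piK rmorphB e subrr.
  rewrite -(rmorph0 (@quot_by_pi _ R)) quot_by_piP subr0 aE.
  by apply/principal_idealP; exists a.
exists (fun y => quot_by_pi R (h y)) => [x|y]; last by rewrite phiE hE.
by apply: inj; rewrite phiE hE.
Qed.
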